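(* Let $(X,\mathscr{A},\mu,T)$ be an ergodic dynamical system. Suppose that for some joining $\lambda\in J_3(T)$ with pairwise independent marginals there exist a compact (metrizable) Abelian group $G$ and a measurable map $\xi: X\to G$ which is not $\mu$-a.e. constant, and such that $$\xi(x_3)=\xi(x_1)+\xi(x_2)\quad\text{for }\lambda\text{-almost every }(x_1,x_2,x_3)\in X^3 .$$ Then $T$ has positive entropy.
   Context: A dynamical system $(X,\mathscr{A},\mu,T)$ consists of a Lebesgue space (equivalently, a standard Borel space with a probability measure $\mu$) and an automorphism $T$ of it: $T$ is an invertible bi-measurable transformation preserving $\mu$. $J_3(T)$ is the set of self-joinings of $T$ of order 3: probability measures $\lambda$ on $X\times X\times X$, invariant under $T\times T\times T$, whose three one-dimensional marginals all equal $\mu$. $\lambda$ has pairwise independent marginals (coordinates) if the marginal of $\lambda$ on any two of the three coordinates is $\mu\otimes\mu$. $G$ is written additively and equipped with its Borel $\sigma$-algebra. Entropy means the Kolmogorov–Sinai entropy of $T$ with respect to $\mu$. *)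

(* Defs.v *)
From HB Require Import structures.
From mathcomp Require Import all_boot all_order all_algebra.
From mathcomp Require Import all_classical all_reals all_analysis.

Set Implicit Arguments.
Unset Strict Implicit.
Unset Printing Implicit Defensive.

Import Order.TTheory GRing.Theory Num.Theory.
Import numFieldNormedType.Exports.

Local Open Scope classical_set_scope.
Local Open Scope ring_scope.

Definition borel_set (Y : topologicalType) : set (set Y) := <<s @open Y >>.

Definition borel_measurable (d : measure_display) (X : measurableType d)
    (Y : topologicalType) (f : X -> Y) : Prop :=
  forall B : set Y, borel_set B -> measurable (f @^-1` B).

Definition separable (Y : topologicalType) : Prop :=
  exists2 D : set Y, countable D & dense D.

(* Completeness as in the library's [completeType], for a [uniformType] that
   need not carry a distinguished point. *)
Definition complete (Y : uniformType) : Prop :=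
  forall F : set_system Y, ProperFilter F -> cauchy F ->
    exists y : Y, F --> y.

Definition metrizable (R : realType) (Y : topologicalType) : Prop :=
  exists (M : metricType R) (f : Y -> M) (g : M -> Y),
    [/\ cancel f g, cancel g f, continuous f & continuous g].

(* [X] is isomorphic, as a measurable space, to a Polish space with its Borel
   sigma-algebra. *)
Definition standard_borel (R : realType) (d : measure_display)
    (X : measurableType d) : Prop :=
  exists (M : metricType R) (f : X -> M),
    [/\ complete M, separable M, bijective f &
        forall A : set X, measurable A <-> borel_set (f @` A)].

Definition measure_preserving (R : realType) (d : measure_display)
    (X : measurableType d) (mu : probability X R) (T : X -> X) : Prop :=
  forall A : set X, measurable A -> pushforward mu T A = mu A.

Definition automorphism (R : realType) (d : measure_display)
    (X : measurableType d) (mu : probability X R) (T : X -> X) : Prop :=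
  exists2 S : X -> X, cancel T S /\ cancel S T &
    [/\ measurable_fun setT T, measurable_fun setT S &
        measure_preserving mu T].

Definition dynamical_system (R : realType) (d : measure_display)
    (X : measurableType d) (mu : probability X R) (T : X -> X) : Prop :=
  standard_borel R X /\ automorphism mu T.

Definition ergodic (R : realType) (d : measure_display)
    (X : measurableType d) (mu : probability X R) (T : X -> X) : Prop :=
  forall A : set X, measurable A -> T @^-1` A = A ->
    mu A = 0%E \/ mu A = 1%E.

(* A point (x1, x2, x3) of X^3 is the nested pair ((x1, x2), x3). *)
Definition self_joining3 (R : realType) (d : measure_display)
    (X : measurableType d) (mu : probability X R) (T : X -> X)
    (lambda : probability (X * X * X)%type R) : Prop :=
  (forall A : set (X * X * X), measurable A ->
    pushforward lambda (fun p => (T p.1.1, T p.1.2, T p.2)) A = lambda A) /\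
  (forall A : set X, measurable A ->
    [/\ pushforward lambda (fun p => p.1.1) A = mu A,
        pushforward lambda (fun p => p.1.2) A = mu A &
        pushforward lambda (fun p => p.2) A = mu A]).

Definition pairwise_independent_marginals (R : realType) (d : measure_display)
    (X : measurableType d) (mu : probability X R)
    (lambda : probability (X * X * X)%type R) : Prop :=
  forall A : set (X * X), measurable A ->
    [/\ pushforward lambda (fun p => (p.1.1, p.1.2)) A = (mu \x mu)%E A,
        pushforward lambda (fun p => (p.1.1, p.2)) A = (mu \x mu)%E A &
        pushforward lambda (fun p => (p.1.2, p.2)) A = (mu \x mu)%E A].

(* Cells may be empty; this affects none of the entropies below, since the
   summand attached to a null cell is 0 * ln 0 = 0. *)
Definition measurable_partition (d : measure_display) (X : measurableType d)
    (I : finType) (P : I -> set X) : Prop :=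
  [/\ forall i, measurable (P i), trivIset setT P & \bigcup_i P i = setT].

Definition partition_entropy (R : realType) (d : measure_display)
    (X : measurableType d) (mu : probability X R)
    (I : finType) (P : I -> set X) : R :=
  - \sum_(i : I) fine (mu (P i)) * ln (fine (mu (P i))).

(* The join of P, T^-1 P, ..., T^-(n-1) P, whose cells are indexed by the
   words of length n in the alphabet I. *)
Definition iterated_join (X : Type) (T : X -> X) (I : finType)
    (P : I -> set X) (n : nat) : {ffun 'I_n -> I} -> set X :=
  fun w => \bigcap_(j : 'I_n) (iter j T @^-1` P (w j)).

Definition partition_entropy_rate (R : realType) (d : measure_display)
    (X : measurableType d) (mu : probability X R) (T : X -> X)
    (I : finType) (P : I -> set X) : \bar R :=
  limn (fun n => (partition_entropy mu (@iterated_join X T I P n)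
                    / n%:R)%:E).

Definition ks_entropy (R : realType) (d : measure_display)
    (X : measurableType d) (mu : probability X R) (T : X -> X) : \bar R :=
  ereal_sup [set h : \bar R | exists (k : nat) (P : 'I_k -> set X),
    measurable_partition P /\ h = partition_entropy_rate mu T P].

(* Main.v *)
Require Import Defs.
From HB Require Import structures.
From mathcomp Require Import all_boot all_order all_algebra.
From mathcomp Require Import all_classical all_reals all_analysis.
From mathcomp Require Import algC separable.
From mathcomp Require Import measurable_realfun complex.
From mathcomp Require Import ring lra zify.

Set Implicit Arguments.
Unset Strict Implicit.
Unset Printing Implicit Defensive.

Import Order.TTheory GRing.Theory Num.Theory.
Import numFieldNormedType.Exports.

Local Open Scope classical_set_scope.
Local Open Scope ring_scope.
Local Notation Re := complex.Re.
Local Notation Im := complex.Im.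

(** Write [mu] for the invariant measure, [rho] for the law of [xi] and [lambda]
    for the joining.

    Characters.  Since [xi(x3) = xi(x1) + xi(x2)] while both [(x1, x2)] and
    [(x1, x3)] are independent pairs, [(g, h) |-> (g, g + h)] preserves
    [rho \x rho]: the law [rho] behaves like a Haar measure
    ([translation_invariance]).  Convolution with respect to [rho] therefore
    makes the bounded functions an involutive algebra of Hilbert-Schmidt
    operators, as for a compact group.  The powers of a self-adjoint kernel,
    suitably normalized, converge to a projection ([top_idempotent]), and a
    minimal projection is one-dimensional, hence a character
    ([minimal_character]).  Starting from a kernel of mean zero, which exists
    because [xi] is not constant, one obtains a function [u] on the space with
    [|u| = 1], mean zero, and [u(x3) = u(x1) u(x2)] almost everywhere
    ([exists_multiplicative]).

    An ideal of integer polynomials.  Call such functions, without the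
    condition on the mean, multiplicative.  The independence of [x1] and [x2]
    makes the mean of a multiplicative function idempotent, so a multiplicative
    function has mean [0] or equals [1] almost everywhere
    ([multf_dichotomy]).  The monomials in [u, u o T, u o T^2, ...] are
    multiplicative; indexed by their vectors of exponents they form the family
    [u^p] for [p] in [Z[X]], where [X] acts as [T].  The [p] with [u^p = 1]
    almost everywhere form an ideal [I], which does not contain [1].  By
    ergodicity [(X^l - X^k) q] belongs to [I], for [k < l], only if [q] does
    ([annihilator_saturated]).

    The alternative.  Call a polynomial flat if its coefficients are in
    [{-1, 0, 1}].
    - Suppose that for some [k > 0] the ideal contains no [p(X^k)] with [p] flat
      and nonzero.  Then the functions [u o T^(kj)] are independent to the
      extent that the Riesz product of the [1 + Re (u(T^(kj) x) / u(T^(kj) y))]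
      for [j < m], as a function of [y], has mean [1].  It is at least
      [(3/2)^m] on the set of points that have the same name as [x] over a time
      [n > k (m - 1)] with respect to the partition of the circle into octants.
      So names of length [n] have probability at most [(2/3)^m], and the
      entropy is at least [ln (3/2) / (2 k) > 0] ([free_entropy_gt0]).
    - Suppose that there is such a [p] for every [k].  Consider a nonzero
      element of [I] of minimal degree; if it is not constant, let [x] be a root
      of it.  Each [x^k] is a root of a flat polynomial, so [|x|^k < 2], whence
      [|x| <= 1].  As in Kronecker's theorem, the remainders of the [X^n] modulo
      the minimal polynomial of [x] are bounded; two of them coincide, so that
      this minimal polynomial divides some [X^l - X^k] and can be cancelled,
      contradicting minimality.  So [I] contains a nonzero constant, and a similar argument
      modulo this constant puts [1] in [I] ([saturated_ideal_full]), which is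
      absurd. *)

(** * Integrals of bounded measurable real functions *)
Section RealIntegral.
Context (R : realType) d (X : measurableType d).
Implicit Types (P : probability X R) (f g : X -> R).

Definition bounded_mf f :=
  measurable_fun setT f /\ exists M : R, forall x, `|f x| <= M.

Definition Er P f : R := \int[P]_x f x.

Lemma bmf_indic (A : set X) : measurable A -> bounded_mf (\1_A : X -> R).
Proof.
move=> mA; split; first exact: measurable_indic.
by exists 1 => x; rewrite indicE; case: (x \in A); rewrite ?normr1 ?normr0.
Qed.

Lemma Er_indic P (A : set X) : measurable A -> Er P \1_A = fine (P A).
Proof. by move=> mA; rewrite /Er /Rintegral integral_indic // setIT. Qed.

Lemma measure_setT1 P : (P : {measure set X -> \bar R}) setT = 1%E.
Proof. exact: probability_setT. Qed.

Lemma bmf_cst (c : R) : bounded_mf (fun=> c).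
Proof. by split; [exact: measurable_cst | exists `|c|]. Qed.

Lemma bmfD f g : bounded_mf f -> bounded_mf g -> bounded_mf (fun x => f x + g x).
Proof.
move=> [mf [M fM]] [mg [N gN]]; split; first exact: measurable_funD.
by exists (M + N) => x; rewrite (le_trans (ler_normD _ _)) // lerD.
Qed.

Lemma bmfM f g : bounded_mf f -> bounded_mf g -> bounded_mf (fun x => f x * g x).
Proof.
move=> [mf [M fM]] [mg [N gN]]; split; first exact: measurable_funM.
by exists (M * N) => x; rewrite normrM ler_pM.
Qed.

Lemma bmfN f : bounded_mf f -> bounded_mf (fun x => - f x).
Proof.
move=> [mf [M fM]]; split; first exact: measurableT_comp.
by exists M => x; rewrite normrN.
Qed.

Lemma bmfB f g : bounded_mf f -> bounded_mf g -> bounded_mf (fun x => f x - g x).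
Proof. by move=> bf bg; apply: bmfD => //; apply: bmfN. Qed.

Lemma bmf_integrable P f : bounded_mf f -> P.-integrable setT (EFin \o f).
Proof.
move=> [mf [M fM]]; apply: measurable_bounded_integrable => //.
  by rewrite measure_setT1 ltry.

exists M; split; first by rewrite num_real.
by move=> x Mx t _; exact: le_trans (fM t) (ltW Mx).
Qed.
Hint Resolve bmf_integrable : core.

Lemma eq_Er P f g : f =1 g -> Er P f = Er P g.
Proof. by move=> fg; rewrite /Er; apply: eq_Rintegral => x _. Qed.

Lemma Er_cst P (c : R) : Er P (fun=> c) = c.
Proof. by rewrite /Er Rintegral_cst // measure_setT1 mulr1. Qed.

Lemma ErD P f g : bounded_mf f -> bounded_mf g ->
  Er P (fun x => f x + g x) = Er P f + Er P g.
Proof. by move=> bf bg; rewrite /Er RintegralD //; apply: bmf_integrable. Qed.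

Lemma ErZ P (c : R) f : bounded_mf f -> Er P (fun x => c * f x) = c * Er P f.
Proof. by move=> bf; rewrite /Er RintegralZl //; apply: bmf_integrable. Qed.

Lemma ErN P f : bounded_mf f -> Er P (fun x => - f x) = - Er P f.
Proof.
move=> bf; rewrite -mulN1r -ErZ //; apply: eq_Er => x; by rewrite mulN1r.
Qed.

Lemma ErB P f g : bounded_mf f -> bounded_mf g ->
  Er P (fun x => f x - g x) = Er P f - Er P g.
Proof. by move=> bf bg; rewrite ErD ?ErN //; apply: bmfN. Qed.

Lemma Er_ge0 P f : (forall x, 0 <= f x) -> 0 <= Er P f.
Proof. by move=> f0; rewrite /Er Rintegral_ge0. Qed.

Lemma le_Er P f g : bounded_mf f -> bounded_mf g ->
  (forall x, f x <= g x) -> Er P f <= Er P g.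
Proof. by move=> bf bg fg; rewrite /Er le_Rintegral //; apply: bmf_integrable. Qed.

Lemma Er_norm_le P f (M : R) : bounded_mf f -> (forall x, `|f x| <= M) ->
  `|Er P f| <= M.
Proof.
move=> bf fM; rewrite ler_norml; apply/andP; split.
  rewrite -[X in X <= _](Er_cst P); apply: le_Er => //; first exact: bmf_cst.
  by move=> x; have := fM x; rewrite ler_norml => /andP[].
rewrite -[X in _ <= X](Er_cst P); apply: le_Er => //; first exact: bmf_cst.
by move=> x; have := fM x; rewrite ler_norml => /andP[].
Qed.

Lemma Er_ae P f g : measurable_fun setT f -> measurable_fun setT g ->
  {ae P, forall x, f x = g x} -> Er P f = Er P g.
Proof.
move=> mf mg fg; rewrite /Er /Rintegral; congr fine.
apply: ae_eq_integral => //; [exact/measurable_EFinP|exact/measurable_EFinP|].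
by apply: filterS fg => x /= -> _.
Qed.

Lemma Er_eq0_ae P f : bounded_mf f -> (forall x, 0 <= f x) -> Er P f = 0 ->
  {ae P, forall x, f x = 0}.
Proof.
move=> bf f0 Ef0.
have /ae_eq_integral_abs H : measurable_fun setT (EFin \o f).
  by apply/measurable_EFinP; case: bf.
have : (\int[P]_x `|(EFin \o f) x|)%E = 0%E.
  have -> : (\int[P]_x `|(EFin \o f) x|)%E = (\int[P]_x (EFin \o f) x)%E.
    by apply: eq_integral => x _ /=; rewrite ger0_norm.
  move: Ef0; rewrite /Er /Rintegral => /eqP.
  have fin : (\int[P]_x (EFin \o f) x)%E \is a fin_num.
    by apply: integrable_fin_num => //; exact: bmf_integrable.
  by move=> /eqP E; rewrite -(fineK fin) /= E.
move=> /(H _ measurableT); apply: filterS => x /= /(_ I) [->] //.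
Qed.

End RealIntegral.

Section RealFubini.
Context (R : realType) d1 d2 (X : measurableType d1) (Y : measurableType d2).
Variables (P : probability X R) (Q : probability Y R).

Lemma bmf_comp (m : X -> Y) (f : Y -> R) : measurable_fun setT m ->
  bounded_mf f -> bounded_mf (fun x => f (m x)).
Proof.
move=> mm [mf [M fM]]; split; last by exists M.
exact: (measurableT_comp mf mm).
Qed.

Lemma Er_comp (m : X -> Y) (f : Y -> R) : measurable_fun setT m ->
  (forall A, measurable A -> P (m @^-1` A) = Q A) ->
  bounded_mf f -> Er P (fun x => f (m x)) = Er Q f.
Proof.
move=> mm PQ bf; rewrite /Er /Rintegral; congr fine.
rewrite -[LHS](@integral_pushforward _ _ _ _ _ _ mm P setT (EFin \o f)) //.
- by apply: eq_measure_integral => A mA _; exact: PQ.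
- by apply/measurable_EFinP; case: bf.
- rewrite preimage_setT; exact: bmf_integrable (bmf_comp mm bf).
Qed.

Lemma ae_comp (m : X -> Y) (A : Y -> Prop) : measurable_fun setT m ->
  (forall B, measurable B -> P (m @^-1` B) = Q B) ->
  {ae Q, forall y, A y} -> {ae P, forall x, A (m x)}.
Proof.
move=> mm PQ [B [mB QB AB]]; exists (m @^-1` B); split.
- by have := mm measurableT _ mB; rewrite setTI.
- by rewrite PQ.
- by move=> x /= nA; apply: AB.
Qed.

Section iterated.
Variable F : X * Y -> R.
Hypothesis bF : bounded_mf F.

Let bmf_prod_integrable : (P \x Q)%E.-integrable setT (EFin \o F).
Proof. exact: (bmf_integrable (P \x Q)%E bF). Qed.

Lemma bmf_section1 x : bounded_mf (fun y => F (x, y)).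
Proof.
case: bF => mF [M FM]; split; first exact: measurable_fun_pair2.
by exists M => y.
Qed.

Lemma bmf_section2 y : bounded_mf (fun x => F (x, y)).
Proof.
case: bF => mF [M FM]; split; first exact: measurable_fun_pair1.
by exists M => x.
Qed.

Let Er1E x : ((Er Q (fun y => F (x, y)))%:E = \int[Q]_y (F (x, y))%:E)%E.
Proof.
by rewrite fineK //; apply: integrable_fin_num => //; exact/bmf_integrable/bmf_section1.
Qed.

Let Er2E y : ((Er P (fun x => F (x, y)))%:E = \int[P]_x (F (x, y))%:E)%E.
Proof.
by rewrite fineK //; apply: integrable_fin_num => //; exact/bmf_integrable/bmf_section2.
Qed.

Lemma bmf_Er1 : bounded_mf (fun x => Er Q (fun y => F (x, y))).
Proof.
split; last first.
  by case: (bF) => _ [M FM]; exists M => x; apply: Er_norm_le => //; apply: bmf_section1.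
apply/measurable_EFinP; have := measurable_fubini_F bmf_prod_integrable.
by apply: eq_measurable_fun => x _ /=; rewrite Er1E.
Qed.

Lemma Er_prod :
  Er P (fun x => Er Q (fun y => F (x, y))) = Er (P \x Q)%E F.
Proof.
transitivity (fine (\int[P]_x fubini_F Q (EFin \o F) x)%E).
  by rewrite [LHS]/Er /Rintegral; congr fine; apply: eq_integral => x _; rewrite Er1E.
by rewrite (integral12_prod_meas1 bmf_prod_integrable).
Qed.

Lemma Er_Fubini : Er P (fun x => Er Q (fun y => F (x, y))) =
  Er Q (fun y => Er P (fun x => F (x, y))).
Proof.
have := Fubini bmf_prod_integrable => H.
rewrite [LHS]/Er [RHS]/Er /Rintegral; congr fine.
transitivity (\int[P]_x \int[Q]_y (EFin \o F) (x, y))%E.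
  by apply: eq_integral => x _; rewrite -Er1E.
by rewrite H; apply: eq_integral => y _; rewrite -Er2E.
Qed.

End iterated.
End RealFubini.

(** * Integrals of bounded measurable complex functions *)
Section ComplexIntegral.
Context (R : realType) d (X : measurableType d).
Implicit Types (P : probability X R) (f g : X -> R[i]).

Definition bounded_mc f :=
  bounded_mf (fun x => Re (f x)) /\ bounded_mf (fun x => Im (f x)).

Definition Ec P f : R[i] :=
  Complex (Er P (fun x => Re (f x))) (Er P (fun x => Im (f x))).

Lemma eq_Ec P f g : f =1 g -> Ec P f = Ec P g.
Proof. by move=> /funext ->. Qed.

Lemma bmc_cst (c : R[i]) : bounded_mc (fun=> c).
Proof. by split; exact: bmf_cst. Qed.

Lemma bmc_real (f : X -> R) : bounded_mf f -> bounded_mc (fun x => (f x)%:C%C).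
Proof. by move=> bf; split => //=; exact: bmf_cst. Qed.

Lemma bmcD f g : bounded_mc f -> bounded_mc g -> bounded_mc (fun x => f x + g x).
Proof.
move=> [rf jf] [rg jg]; split.
  rewrite (_ : (fun x => _) = (fun x => Re (f x) + Re (g x))); first exact: bmfD.
  by apply/funext => x; case: (f x) (g x) => [a b] [a' b'].
rewrite (_ : (fun x => _) = (fun x => Im (f x) + Im (g x))); first exact: bmfD.
by apply/funext => x; case: (f x) (g x) => [a b] [a' b'].
Qed.

Lemma ReM (a b : R[i]) : Re (a * b) = Re a * Re b - Im a * Im b.
Proof. by case: a b => [a a'] [b b']. Qed.

Lemma ImM (a b : R[i]) : Im (a * b) = Re a * Im b + Im a * Re b.
Proof. by case: a b => [a a'] [b b']. Qed.

Lemma bmcM f g : bounded_mc f -> bounded_mc g -> bounded_mc (fun x => f x * g x).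
Proof.
move=> [rf jf] [rg jg]; split.
  under eq_fun do rewrite ReM.
  by apply: bmfB; apply: bmfM.
under eq_fun do rewrite ImM.
by apply: bmfD; apply: bmfM.
Qed.

Lemma bmc_conj f : bounded_mc f -> bounded_mc (fun x => (f x)^*%C).
Proof.
move=> [rf jf]; split.
  by rewrite (_ : (fun x => _) = (fun x => Re (f x))) //; apply/funext => x; case: (f x).
rewrite (_ : (fun x => _) = (fun x => - Im (f x))); first exact: bmfN.
by apply/funext => x; case: (f x).
Qed.

Lemma bmcN f : bounded_mc f -> bounded_mc (fun x => - f x).
Proof.
move=> bf; under eq_fun do rewrite -mulN1r.
exact: (bmcM (bmc_cst (-1)) bf).
Qed.

Lemma bmcB f g : bounded_mc f -> bounded_mc g -> bounded_mc (fun x => f x - g x).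
Proof. by move=> bf bg; apply: bmcD => //; apply: bmcN. Qed.

Lemma bmc_sum (I : Type) (r : seq I) (F : I -> X -> R[i]) :
  (forall i, bounded_mc (F i)) -> bounded_mc (fun x => \sum_(i <- r) F i x).
Proof.
move=> bF; elim: r => [|i r IH].
  by (under eq_fun do rewrite big_nil); exact: bmc_cst.
by (under eq_fun do rewrite big_cons); exact: bmcD.
Qed.

Lemma Ec_eq0 P f : Ec P f = 0 ->
  Er P (fun x => Re (f x)) = 0 /\ Er P (fun x => Im (f x)) = 0.
Proof. by rewrite /Ec => -[]. Qed.

Lemma Ec_cst P (c : R[i]) : Ec P (fun=> c) = c.
Proof. by rewrite /Ec !Er_cst; case: c. Qed.

Lemma EcD P f g : bounded_mc f -> bounded_mc g ->
  Ec P (fun x => f x + g x) = Ec P f + Ec P g.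
Proof.
move=> [rf jf] [rg jg]; rewrite /Ec; simpc; rewrite -!ErD //.
by congr Complex; apply: eq_Er => x; case: (f x) (g x) => [a b] [a' b'].
Qed.

Lemma EcZ P (c : R[i]) f : bounded_mc f -> Ec P (fun x => c * f x) = c * Ec P f.
Proof.
case: c => a b [rf jf]; rewrite /Ec; simpc.
have bZ (k : R) (h : X -> R) : bounded_mf h -> bounded_mf (fun x => k * h x).
  by move=> bh; exact: (bmfM (bmf_cst X k) bh).
rewrite -!ErZ // -ErB -?ErD; try exact: bZ.
by congr Complex; apply: eq_Er => x; rewrite ?ReM ?ImM.
Qed.

Lemma EcZr P (c : R[i]) f : bounded_mc f -> Ec P (fun x => f x * c) = Ec P f * c.
Proof. by move=> bf; rewrite mulrC -EcZ //; apply: eq_Ec => x; rewrite mulrC. Qed.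

Lemma EcN P f : bounded_mc f -> Ec P (fun x => - f x) = - Ec P f.
Proof.
by move=> bf; rewrite -mulN1r -EcZ //; apply: eq_Ec => x; rewrite mulN1r.
Qed.

Lemma EcB P f g : bounded_mc f -> bounded_mc g ->
  Ec P (fun x => f x - g x) = Ec P f - Ec P g.
Proof. by move=> bf bg; rewrite EcD ?EcN //; apply: bmcN. Qed.

Lemma Ec_conj P f : bounded_mc f -> Ec P (fun x => (f x)^*%C) = (Ec P f)^*%C.
Proof.
move=> [rf jf]; rewrite /Ec /= -ErN //.
by congr Complex; apply: eq_Er => x; case: (f x).
Qed.

Lemma Ec_sum P (I : Type) (r : seq I) (F : I -> X -> R[i]) :
  (forall i, bounded_mc (F i)) ->
  Ec P (fun x => \sum_(i <- r) F i x) = \sum_(i <- r) Ec P (F i).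
Proof.
move=> bF; elim: r => [|i r IH].
  by rewrite big_nil -[RHS](Ec_cst P); apply: eq_Ec => x; rewrite big_nil.
rewrite big_cons -IH -EcD //; last exact: bmc_sum.
by apply: eq_Ec => x; rewrite big_cons.
Qed.

Lemma Ec_real P (f : X -> R) : Ec P (fun x => (f x)%:C%C) = (Er P f)%:C%C.
Proof. by rewrite /Ec /= Er_cst. Qed.

Lemma Ec_ae P f g : bounded_mc f -> bounded_mc g ->
  {ae P, forall x, f x = g x} -> Ec P f = Ec P g.
Proof.
move=> [[rf _] [jf _]] [[rg _] [jg _]] fg; rewrite /Ec.
by congr Complex; apply: Er_ae => //; apply: filterS fg => x ->.
Qed.

Lemma Ec_ge0 P f : (forall x, 0 <= f x) -> 0 <= Ec P f.
Proof.
move=> f0; have fE x : f x = (Re (f x))%:C%C by rewrite RRe_real // ger0_real.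
under eq_Ec do rewrite fE.
by rewrite Ec_real lecR Er_ge0 // => x; rewrite -lecR -fE.
Qed.

Lemma Ec_eq0_ae P f : bounded_mc f -> (forall x, 0 <= f x) -> Ec P f = 0 ->
  {ae P, forall x, f x = 0}.
Proof.
move=> [bf _] f0; have fE x : f x = (Re (f x))%:C%C by rewrite RRe_real // ger0_real.
under eq_Ec do rewrite fE.
rewrite Ec_real => /complexI E0; apply: filterS (Er_eq0_ae bf _ E0) => [x|x].
  by rewrite fE => ->.
by rewrite -lecR -fE.
Qed.

Definition dotc P f g := Ec P (fun x => f x * (g x)^*%C).

Lemma bmc_dot f g : bounded_mc f -> bounded_mc g ->
  bounded_mc (fun x => f x * (g x)^*%C).
Proof. by move=> bf bg; apply: bmcM => //; apply: bmc_conj. Qed.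

Lemma dotcC P f g : bounded_mc f -> bounded_mc g -> dotc P g f = (dotc P f g)^*%C.
Proof.
move=> bf bg; rewrite /dotc -Ec_conj; last exact: bmc_dot.
by apply: eq_Ec => x; rewrite rmorphM /= conjcK mulrC.
Qed.

Lemma dotc_ge0 P f : 0 <= dotc P f f.
Proof. by apply: Ec_ge0 => x; exact: mulcJ_ge0. Qed.

Lemma dotc_eq0 P f : bounded_mc f -> dotc P f f = 0 -> {ae P, forall x, f x = 0}.
Proof.
move=> bf f0.
have := Ec_eq0_ae (bmc_dot bf bf) (fun x => mulcJ_ge0 _) f0.
by apply: filterS => x /eqP; rewrite mulf_eq0 conjc_eq0 orbb => /eqP.
Qed.

Lemma dotcZl P c f h : bounded_mc f -> bounded_mc h ->
  dotc P (fun x => c * f x) h = c * dotc P f h.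
Proof.
move=> bf bh; rewrite /dotc -EcZ; last exact: bmc_dot.
by apply: eq_Ec => x; rewrite mulrA.
Qed.

Lemma dotcZr P c f h : bounded_mc f -> bounded_mc h ->
  dotc P h (fun x => c * f x) = c^*%C * dotc P h f.
Proof.
move=> bf bh; rewrite /dotc -EcZ; last exact: bmc_dot.
by apply: eq_Ec => x; rewrite rmorphM mulrCA.
Qed.

Lemma dotcBl P f g h : bounded_mc f -> bounded_mc g -> bounded_mc h ->
  dotc P (fun x => f x - g x) h = dotc P f h - dotc P g h.
Proof.
move=> bf bg bh; rewrite /dotc -EcB; try exact: bmc_dot.
by apply: eq_Ec => x; rewrite mulrBl.
Qed.

Lemma dotcBr P f g h : bounded_mc f -> bounded_mc g -> bounded_mc h ->
  dotc P h (fun x => f x - g x) = dotc P h f - dotc P h g.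
Proof.
move=> bf bg bh; rewrite /dotc -EcB; try exact: bmc_dot.
by apply: eq_Ec => x; rewrite rmorphB mulrBr.
Qed.

Lemma dotc_CS P f g : bounded_mc f -> bounded_mc g ->
  `|dotc P f g| ^+ 2 <= dotc P f f * dotc P g g.
Proof.
move=> bf bg; set a := dotc P f f; set b := dotc P g g; set c := dotc P f g.
have [b0|bn0] := eqVneq b 0.
  rewrite b0 mulr0 (_ : c = 0) ?normr0 ?expr0n // /c /dotc -[RHS](Ec_cst P).
  apply: Ec_ae; [exact: bmc_dot|exact: bmc_cst|].
  by apply: filterS (dotc_eq0 bg b0) => x ->; rewrite conjc0 mulr0.
have bgt0 : 0 < b by rewrite lt_def bn0 dotc_ge0.
have bconj : b^*%C = b by rewrite /b -dotcC.
have : 0 <= dotc P (fun x => b * f x - c * g x) (fun x => b * f x - c * g x).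
  exact: dotc_ge0.
have bcf : bounded_mc (fun x => b * f x) by apply: bmcM => //; exact: bmc_cst.
have bcg : bounded_mc (fun x => c * g x) by apply: bmcM => //; exact: bmc_cst.
rewrite dotcBl ?dotcBr ?dotcZl ?dotcZr //; try exact: bmcB.
rewrite (dotcC _ bf bg) -/a -/b -/c bconj.
rewrite (_ : _ - _ = b * (a * b - c * c^*%C)); last by ring.
by rewrite pmulr_rge0 // subr_ge0 sqr_normc.
Qed.

Lemma Ec_norm_le1 P f : bounded_mc f -> `|Ec P f| ^+ 2 <= dotc P f f.
Proof.
move=> bf; have := dotc_CS P bf (bmc_cst 1).
rewrite /dotc; under eq_Ec do rewrite conjc1 mulr1.
by under [X in _ * X]eq_Ec do rewrite conjc1 mulr1; rewrite Ec_cst mulr1.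
Qed.

End ComplexIntegral.

Section ComplexFubini.
Context (R : realType) d1 d2 (X : measurableType d1) (Y : measurableType d2).
Variables (P : probability X R) (Q : probability Y R).

Lemma bmc_comp (m : X -> Y) (f : Y -> R[i]) : measurable_fun setT m ->
  bounded_mc f -> bounded_mc (fun x => f (m x)).
Proof.
by move=> mm [rf jf]; split; [exact: (bmf_comp mm rf) | exact: (bmf_comp mm jf)].
Qed.

Lemma Ec_comp (m : X -> Y) (f : Y -> R[i]) : measurable_fun setT m ->
  (forall A, measurable A -> P (m @^-1` A) = Q A) ->
  bounded_mc f -> Ec P (fun x => f (m x)) = Ec Q f.
Proof.
move=> mm PQ [rf jf]; rewrite /Ec.
by rewrite (Er_comp mm PQ rf) (Er_comp mm PQ jf).
Qed.

Variable F : X * Y -> R[i].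
Hypothesis bF : bounded_mc F.

Lemma bmc_section1 x : bounded_mc (fun y => F (x, y)).
Proof. by case: bF => rF jF; split; [exact: (bmf_section1 rF)|exact: (bmf_section1 jF)]. Qed.

Lemma bmc_Ec1 : bounded_mc (fun x => Ec Q (fun y => F (x, y))).
Proof. by case: bF => rF jF; split => /=; [exact: (bmf_Er1 P Q rF)|exact: (bmf_Er1 P Q jF)]. Qed.

Lemma Ec_prod : Ec P (fun x => Ec Q (fun y => F (x, y))) = Ec (P \x Q)%E F.
Proof.
case: bF => rF jF; rewrite /Ec; congr Complex.
  exact: (Er_prod P Q rF).
exact: (Er_prod P Q jF).
Qed.

Lemma Ec_Fubini : Ec P (fun x => Ec Q (fun y => F (x, y))) =
  Ec Q (fun y => Ec P (fun x => F (x, y))).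
Proof.
case: bF => rF jF; rewrite /Ec; congr Complex.
  exact: (Er_Fubini P Q rF).
exact: (Er_Fubini P Q jF).
Qed.

End ComplexFubini.

(** * The squared modulus and the squared L2 norm *)
Definition sqmod (R : realType) (z : R[i]) : R := Re z ^+ 2 + Im z ^+ 2.

Section SquaredModulus.
Context (R : realType).
Implicit Types z w : R[i].

Lemma sqmodE z : (sqmod z)%:C%C = z * z^*%C.
Proof. by rewrite /sqmod add_Re2_Im2 sqr_normc. Qed.

Lemma sqmod_ge0 z : 0 <= sqmod z.
Proof. by rewrite addr_ge0 // sqr_ge0. Qed.

Lemma sqmodM z w : sqmod (z * w) = sqmod z * sqmod w.
Proof. by case: z w => [a b] [c d]; rewrite /sqmod /=; ring. Qed.

Lemma sqmod_conj z : sqmod z^*%C = sqmod z.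
Proof. by case: z => [a b]; rewrite /sqmod /= sqrrN. Qed.

Lemma sqmodN z : sqmod (- z) = sqmod z.
Proof. by case: z => [a b]; rewrite /sqmod /= !sqrrN. Qed.

Lemma sqmod_real (r : R) : sqmod r%:C%C = r ^+ 2.
Proof. by rewrite /sqmod /= expr0n addr0. Qed.

Lemma sqmodD_le z w : sqmod (z + w) <= 2 * sqmod z + 2 * sqmod w.
Proof.
case: z w => [a b] [c d]; rewrite /sqmod /=.
have := sqr_ge0 (a - c); have := sqr_ge0 (b - d); nra.
Qed.

Lemma sqmod_eq0 z : sqmod z <= 0 -> z = 0.
Proof.
case: z => [a b]; rewrite /sqmod /= => H.
have a0 : a = 0 by apply/eqP; rewrite -sqrf_eq0 eq_le sqr_ge0 andbT; have := sqr_ge0 b; lra.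
have b0 : b = 0 by apply/eqP; rewrite -sqrf_eq0 eq_le sqr_ge0 andbT; have := sqr_ge0 a; lra.
by rewrite a0 b0.
Qed.

Lemma normc2 z : `|z| ^+ 2 = (sqmod z)%:C%C.
Proof. by rewrite -add_Re2_Im2. Qed.

Context d (X : measurableType d).
Implicit Types (f g : X -> R[i]) (P : probability X R).

Lemma bmf_sqmod f : bounded_mc f -> bounded_mf (fun x => sqmod (f x)).
Proof. by move=> [rf jf]; apply: bmfD; apply: bmfM. Qed.

Lemma bmc_boundsqmod f : bounded_mc f -> exists2 M : R, 0 <= M & forall x, sqmod (f x) <= M.
Proof.
move=> /bmf_sqmod [_ [M fM]]; exists `|M| => // x.
by rewrite (le_trans (ler_norm _)) // (le_trans (fM x)) // ler_norm.
Qed.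

Definition nrm2 P f : R := Er P (fun x => sqmod (f x)).

Lemma nrm2E P f : (nrm2 P f)%:C%C = dotc P f f.
Proof. by rewrite /nrm2 -Ec_real; apply: eq_Ec => x; rewrite sqmodE. Qed.

Lemma nrm2_ge0 P f : 0 <= nrm2 P f.
Proof. by apply: Er_ge0 => x; exact: sqmod_ge0. Qed.

Lemma nrm2_le P f (M : R) : bounded_mc f -> (forall x, sqmod (f x) <= M) -> nrm2 P f <= M.
Proof.
move=> bf fM; rewrite -[leRHS](Er_cst P); apply: le_Er => //; last exact: bmf_cst.
exact: bmf_sqmod.
Qed.

Lemma dot_CS P f g : bounded_mc f -> bounded_mc g ->
  sqmod (dotc P f g) <= nrm2 P f * nrm2 P g.
Proof.
by move=> bf bg; have := dotc_CS P bf bg; rewrite normc2 -!nrm2E -rmorphM /= lecR.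
Qed.

Lemma nrm2_eq0 P f : bounded_mc f -> nrm2 P f = 0 -> {ae P, forall x, f x = 0}.
Proof. by move=> bf n0; apply: dotc_eq0 => //; rewrite -nrm2E n0. Qed.

Lemma nrm2B P f g : bounded_mc f -> bounded_mc g ->
  nrm2 P (fun x => f x - g x) = nrm2 P f - 2 * Re (dotc P f g) + nrm2 P g.
Proof.
move=> bf bg; apply: complexI; rewrite nrm2E dotcBl ?dotcBr //; last exact: bmcB.
rewrite (dotcC P bf bg) -!nrm2E; case: (dotc P f g) => a b.
by apply/eqP; rewrite eq_complex /=; apply/andP; split; apply/eqP; ring.
Qed.

End SquaredModulus.

(** * Uniform limits *)
Section UniformLimits.
Context (R : realType) d (X : measurableType d).

Let uniform_limit_real (u : nat -> X -> R) :
  (forall j, bounded_mf (u j)) ->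
  (forall e : R, 0 < e -> exists N, forall i j, (N <= i)%N -> (N <= j)%N ->
     forall x, (u i x - u j x) ^+ 2 <= e) ->
  exists2 f : X -> R, bounded_mf f & forall e : R, 0 < e ->
    exists N, forall j, (N <= j)%N -> forall x, (u j x - f x) ^+ 2 <= e.
Proof.
move=> bu Cu.
have cv x : cvgn (fun j => u j x).
  apply/cauchy_cvgP/cauchy_exP => e e0.
  have [N NP] := Cu (e ^+ 2 / 4) ltac:(by rewrite divr_gt0 // exprn_gt0).
  exists (u N x); exists N => // j /= Nj.
  rewrite /ball /= -(@ltr_pXn2r _ 2) ?nnegrE ?normr_ge0 ?ltW //.
  rewrite real_normK ?num_real //; apply: le_lt_trans (NP N j _ Nj x) _ => //.
  by have := exprn_gt0 2 e0; lra.
pose f x := limn (fun j => u j x).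
have fl (e : R) N x : (forall i j, (N <= i)%N -> (N <= j)%N ->
    (u i x - u j x) ^+ 2 <= e) -> forall j, (N <= j)%N -> (u j x - f x) ^+ 2 <= e.
  move=> H j Nj.
  have L : (fun i => (u j x - u i x) ^+ 2) @ \oo --> (u j x - f x) ^+ 2.
    apply: (@cvg_comp _ _ _ (fun i => u j x - u i x) (fun y : R => y ^+ 2)); last first.
      exact: exprn_continuous.
    by apply: cvgB; [exact: cvg_cst|exact: cv].
  rewrite -(cvg_lim _ L) //; apply: limr_le.
    by apply/cvg_ex; exists ((u j x - f x) ^+ 2).
  by exists N => // i /= Ni; exact: H.
have fu (e : R) : 0 < e -> exists N, forall j, (N <= j)%N -> forall x, (u j x - f x) ^+ 2 <= e.
  move=> e0; have [N NP] := Cu e e0; exists N => j Nj x.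
  by apply: (fl _ N) => // i k Ni Nk; exact: NP.
exists f => //; split.
  apply: (@measurable_fun_cvg _ _ _ _ (fun j x => u j x)) => [m|x _]; last exact: cv.
  by case: (bu m).
have [N NP] := fu 1 ltr01; have [_ [M uM]] := bu N; exists (M + 1) => x.
have H : `|u N x - f x| <= 1.
  by rewrite -(@ler_pXn2r _ 2) ?nnegrE ?normr_ge0 // expr1n real_normK ?num_real // NP.
rewrite -[f x](subKr (u N x)); apply: le_trans (ler_normB _ _) _.
by rewrite lerD.
Unshelve. all: by end_near.
Qed.

(** Distances are squared because [sqmod], unlike the modulus, takes its values in
    [R]. *)
Definition uniform_cvg (v : nat -> X -> R[i]) (f : X -> R[i]) :=
  forall e : R, 0 < e -> exists N, forall j, (N <= j)%N ->
    forall x, sqmod (v j x - f x) <= e.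

Lemma uniform_limit (v : nat -> X -> R[i]) : (forall j, bounded_mc (v j)) ->
  (forall e : R, 0 < e -> exists N, forall i j, (N <= i)%N -> (N <= j)%N ->
     forall x, sqmod (v i x - v j x) <= e) ->
  exists2 f, bounded_mc f & uniform_cvg v f.
Proof.
move=> bv Cv.
have sqmodRe (z w : R[i]) : (Re z - Re w) ^+ 2 <= sqmod (z - w).
  by case: z w => [a b] [a' b']; rewrite /sqmod /= lerDl sqr_ge0.
have sqmodIm (z w : R[i]) : (Im z - Im w) ^+ 2 <= sqmod (z - w).
  by case: z w => [a b] [a' b']; rewrite /sqmod /= lerDr sqr_ge0.
have [f bf Hf] := @uniform_limit_real (fun j x => Re (v j x))
  (fun j => (bv j).1) ltac:(move=> e e0; have [N NP] := Cv e e0; exists N => i j Ni Nj x;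
     exact: le_trans (sqmodRe _ _) (NP i j Ni Nj x)).
have [g bg Hg] := @uniform_limit_real (fun j x => Im (v j x))
  (fun j => (bv j).2) ltac:(move=> e e0; have [N NP] := Cv e e0; exists N => i j Ni Nj x;
     exact: le_trans (sqmodIm _ _) (NP i j Ni Nj x)).
exists (fun x => Complex (f x) (g x)); first by split.
move=> e e0; have e20 : 0 < e / 2 by rewrite divr_gt0.
have [N NP] := Hf _ e20; have [M MP] := Hg _ e20.
exists (maxn N M) => j; rewrite geq_max => /andP[Nj Mj] x.
have := NP j Nj x; have := MP j Mj x; rewrite /sqmod.
by case: (v j x) => a b /=; lra.
Qed.

Lemma uniform_cvg_uniq v f g : uniform_cvg v f -> uniform_cvg v g -> f = g.
Proof.
move=> vf vg; apply/funext => x; apply/eqP; rewrite -subr_eq0; apply/eqP.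
apply: sqmod_eq0; rewrite leNgt; apply/negP => p0.
have e0 : 0 < sqmod (f x - g x) / 5 by rewrite divr_gt0.
have [N NP] := vf _ e0; have [M MP] := vg _ e0.
have H1 := NP (maxn N M) (leq_maxl _ _) x; have H2 := MP (maxn N M) (leq_maxr _ _) x.
have := sqmodD_le (- (v (maxn N M) x - f x)) (v (maxn N M) x - g x).
by rewrite sqmodN (_ : - _ + _ = f x - g x); [lra|ring].
Qed.

Lemma uniform_cvg_shift v f k : uniform_cvg v f -> uniform_cvg (fun j => v (k + j)%N) f.
Proof.
move=> vf e e0; have [N NP] := vf e e0; exists N => j Nj x.
by apply: NP; rewrite (leq_trans Nj) // leq_addl.
Qed.

Lemma uniform_cvg_Ec0 (P : probability X R) v f : (forall j, bounded_mc (v j)) ->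
  bounded_mc f -> uniform_cvg v f -> (forall j, Ec P (v j) = 0) -> Ec P f = 0.
Proof.
move=> bv bf vf v0; apply: sqmod_eq0; rewrite leNgt; apply/negP => p0.
have e0 : 0 < sqmod (Ec P f) / 2 by rewrite divr_gt0.
have [N NP] := vf _ e0; have H := nrm2_le P (bmcB (bv N) bf) (NP N (leqnn N)).
have := Ec_norm_le1 P (bmcB (bv N) bf); rewrite EcB // v0 sub0r -nrm2E normc2 sqmodN lecR.
by lra.
Qed.

End UniformLimits.

(** * Convolution with respect to a self-invariant law *)

(** By log-convexity the ratios [c n.+1 / c n] increase; by
    submultiplicativity they are bounded by [c 0].  Their limit is [s]. *)
Lemma log_convex_growth (R : realType) (c : nat -> R) :
  (forall n, 0 <= c n) -> 0 < c 1%N ->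
  (forall n, c n.+1 ^+ 2 <= c n * c n.+2) ->
  (forall i j, c (i + j).+1 <= c i * c j) ->
  exists2 s : R, 0 < s & forall n, c n.+1 <= s * c n /\ s ^+ n.+1 <= c n.
Proof.
move=> c0 c1 lc sm.
have cpos n : 0 < c n.
  have H : 0 < c n /\ 0 < c n.+1.
    elim: n => [|n [_ IH]].
      split=> //; rewrite lt_def c0 andbT; apply: contraTneq (lc 0) => ->.
      by rewrite mul0r -ltNge exprn_gt0.
    split=> //; rewrite lt_def c0 andbT; apply: contraTneq (lc n) => ->.
    by rewrite mulr0 -ltNge exprn_gt0.
  by case: H.
pose r n := c n.+1 / c n.
have rpos n : 0 < r n by rewrite divr_gt0.
have rE n : c n.+1 = r n * c n by rewrite /r divfK // gt_eqF.
have rS n : r n <= r n.+1.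
  by rewrite /r ler_pdivlMr // mulrAC ler_pdivrMr // -expr2 mulrC.
have rmono : {homo r : n m / (n <= m)%N >-> n <= m}.
  by apply: homo_leq => // y x z; exact: le_trans.
have rb n : r n <= c 0.
  by rewrite /r ler_pdivrMr //; have := sm 0 n.
have rub : has_ubound (range r) by exists (c 0) => _ [n _ <-].
have rcvg : cvgn r by exact: nondecreasing_is_cvgn.
set s := limn r.
have rs n : r n <= s by exact: nondecreasing_cvgn_le.
exists s; first exact: lt_le_trans (rpos 0) (rs 0).
move=> n; split; first by rewrite rE ler_wpM2r // ltW.
have grow j m : r j ^+ m * c j <= c (j + m)%N.
  elim: m => [|m IH]; first by rewrite expr0 mul1r addn0.
  rewrite addnS rE exprS -mulrA; apply: ler_pM => //; first exact: ltW.
    by rewrite mulr_ge0 ?exprn_ge0 // ltW.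
  by apply: rmono; exact: leq_addr.
have le_j j : r j ^+ n.+1 <= c n.
  rewrite -(ler_pM2r (cpos j)); apply: le_trans (grow j n.+1) _.
  by rewrite addnS addnC sm.
have : (fun j => r j ^+ n.+1) @ \oo --> s ^+ n.+1.
  by apply: (@cvg_comp _ _ _ r (fun x => x ^+ n.+1) _ _ _ rcvg); exact: exprn_continuous.
move=> H; rewrite -(cvg_lim _ H) //; apply: limr_le; first by apply/cvg_ex; exists (s ^+ n.+1).
by near=> j; exact: le_j.
Unshelve. all: by end_near.
Qed.

(** A copy of the group that carries its Borel sigma-algebra, to serve as a
    measurable space. *)
Definition borelG (G : topologicalZmodType) : Type := G.
HB.instance Definition _ G := GRing.Zmodule.copy (borelG G) G.
HB.instance Definition _ G := isPointed.Build (borelG G) 0.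
HB.instance Definition _ (G : topologicalZmodType) :=
  @isMeasurable.Build (sigma_display (@open G)) (borelG G) <<s @open G >>
    (@sigma_algebra0 _ setT (@open G))
    (@sigma_algebraC (borelG G) (@open G))
    (@sigma_algebra_bigcup _ setT (@open G)).

Section Convolution.
Context (R : realType) (G : topologicalZmodType).
Notation Y := (borelG G).
Variable rho : probability Y R.
Hypothesis measurable_sub : measurable_fun setT (fun p : Y * Y => p.1 - p.2).
(** The map [(g, h) |-> (g, g + h)] preserves [rho \x rho].  Haar measure has this
    property, and the arguments below that are familiar from compact groups use
    nothing more about [rho]. *)
Hypothesis invariance : forall F : Y * Y -> R[i], bounded_mc F ->
  Ec rho (fun g => Ec rho (fun h => F (g, g + h))) =
  Ec rho (fun g => Ec rho (fun h => F (g, h))).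

Section MeasurableOps.
Context d (Z : measurableType d).
Implicit Types f g : Z -> Y.

Lemma mfun_sub f g : measurable_fun setT f -> measurable_fun setT g ->
  measurable_fun setT (fun z => f z - g z).
Proof.
move=> mf mg.
exact: (measurableT_comp measurable_sub (measurable_fun_pair mf mg)).
Qed.

Lemma mfun_opp f : measurable_fun setT f -> measurable_fun setT (fun z => - f z).
Proof.
move=> mf; under eq_fun do rewrite -sub0r.
by apply: mfun_sub => //; exact: measurable_cst.
Qed.

Lemma mfun_add f g : measurable_fun setT f -> measurable_fun setT g ->
  measurable_fun setT (fun z => f z + g z).
Proof.
move=> mf mg; under eq_fun do rewrite -[g _]opprK.
by apply: mfun_sub => //; exact: mfun_opp.
Qed.

End MeasurableOps.

Ltac mt := repeat first
  [ assumption | exact: measurable_id | exact: measurable_cst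
  | exact: measurable_fst | exact: measurable_snd
  | apply: mfun_sub | apply: mfun_add | apply: mfun_opp ].

(** Bounded measurability of the integrands below, by descent on their syntax;
    an inner integral is treated as a section of a function of two variables. *)
Ltac bc := repeat first
  [ assumption
  | exact: bmc_cst
  | match goal with
    | H : bounded_mc ?a |- bounded_mc (fun x => ?a (@?m x)) =>
        apply: (@bmc_comp _ _ _ _ _ m a _ H); solve [mt]
    | |- bounded_mc (fun g => Ec ?P (fun h => @?F g h)) =>
        apply: (@bmc_Ec1 _ _ _ _ _ P P (fun p => F p.1 p.2))
    end
  | apply: bmcB | apply: bmcD | apply: bmcN | apply: bmc_conj | apply: bmcM ].

Lemma Ec_swap (F : Y -> Y -> R[i]) : bounded_mc (fun p => F p.1 p.2) ->
  Ec rho (fun g => Ec rho (fun h => F g h)) =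
  Ec rho (fun h => Ec rho (fun g => F g h)).
Proof. exact: (@Ec_Fubini _ _ _ _ _ rho rho (fun p => F p.1 p.2)). Qed.

Lemma Ec_shift (F : Y -> Y -> R[i]) : bounded_mc (fun p => F p.1 p.2) ->
  Ec rho (fun g => Ec rho (fun h => F g (g + h))) =
  Ec rho (fun g => Ec rho (fun h => F g h)).
Proof. exact: (@invariance (fun p => F p.1 p.2)). Qed.

Implicit Types a b c : Y -> R[i].

Lemma Ec_shift_sub a : bounded_mc a ->
  Ec rho (fun g => Ec rho (fun h => a (h - g))) = Ec rho a.
Proof.
move=> ba; rewrite -(@Ec_shift (fun g h => a (h - g))); last by bc.
rewrite -[RHS](Ec_cst rho); apply: eq_Ec => g; apply: eq_Ec => h.
by rewrite addrC addKr.
Qed.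

Lemma Ec_opp a : bounded_mc a -> Ec rho (fun g => a (- g)) = Ec rho a.
Proof.
move=> ba; rewrite -(@Ec_shift_sub (fun g => a (- g))); last by bc.
rewrite -(Ec_shift_sub ba) Ec_swap; last by bc.
by apply: eq_Ec => g; apply: eq_Ec => h; rewrite opprB.
Qed.

Lemma Ec_shift_subr a : bounded_mc a ->
  Ec rho (fun g => Ec rho (fun h => a (g - h))) = Ec rho a.
Proof. by move=> ba; rewrite Ec_swap; [exact: Ec_shift_sub|bc]. Qed.

Lemma Ec_shift_add a : bounded_mc a ->
  Ec rho (fun g => Ec rho (fun h => a (g + h))) = Ec rho a.
Proof.
move=> ba; rewrite (@Ec_shift (fun g h => a h)) ?Ec_cst //; by bc.
Qed.

Definition conv a b : Y -> R[i] := fun g => Ec rho (fun h => a (g - h) * b h).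
Definition star a : Y -> R[i] := fun g => (a (- g))^*%C.
Local Notation dot := (dotc rho).
Local Notation nrm := (nrm2 rho).

Lemma bmc_conv a b : bounded_mc a -> bounded_mc b -> bounded_mc (conv a b).
Proof. by move=> ba bb; rewrite /conv; bc. Qed.

Lemma bmc_star a : bounded_mc a -> bounded_mc (star a).
Proof. by move=> ba; rewrite /star; bc. Qed.

Ltac bc ::= repeat first
  [ assumption
  | exact: bmc_cst
  | match goal with
    | H : bounded_mc ?a |- bounded_mc (fun x => ?a (@?m x)) =>
        apply: (@bmc_comp _ _ _ _ _ m a _ H); solve [mt]
    | |- bounded_mc (fun g => Ec ?P (fun h => @?F g h)) =>
        apply: (@bmc_Ec1 _ _ _ _ _ P P (fun p => F p.1 p.2))
    end
  | apply: bmcB | apply: bmcD | apply: bmcN | apply: bmc_conj | apply: bmcM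
  | apply: bmc_conv | apply: bmc_star ].

Lemma convA a b c : bounded_mc a -> bounded_mc b -> bounded_mc c ->
  conv (conv a b) c = conv a (conv b c).
Proof.
move=> ba bb bc'; apply/funext => g; rewrite /conv.
transitivity (Ec rho (fun h => Ec rho (fun k => a (g - (h + k)) * b (h + k - h) * c h))).
  apply: eq_Ec => h; rewrite -EcZr; last by bc.
  by apply: eq_Ec => k; rewrite opprD addrA [h + k]addrC addrK.
rewrite (@Ec_shift (fun h k => a (g - k) * b (k - h) * c h)); last by bc.
rewrite Ec_swap; last by bc.
apply: eq_Ec => h; rewrite -EcZ; last by bc.
by apply: eq_Ec => k; rewrite mulrA.
Qed.

Lemma star_conv a b : bounded_mc a -> bounded_mc b ->
  star (conv a b) = conv (star a) (star b).
Proof.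
move=> ba bb; apply/funext => g; rewrite /star /conv -Ec_conj; last by bc.
rewrite -[RHS]Ec_opp; last by bc.
by apply: eq_Ec => h; rewrite rmorphM /= !opprK opprD.
Qed.

Lemma dot_conv a b c : bounded_mc a -> bounded_mc b -> bounded_mc c ->
  dot (conv a b) c = dot b (conv (star a) c).
Proof.
move=> ba bb bc'; rewrite /dotc /conv /star.
transitivity (Ec rho (fun g => Ec rho (fun h => a (g - h) * b h * (c g)^*%C))).
  by apply: eq_Ec => g; rewrite EcZr //; bc.
rewrite Ec_swap; last by bc.
apply: eq_Ec => h; rewrite -Ec_conj; last by bc.
rewrite -EcZ; last by bc.
apply: eq_Ec => g; rewrite rmorphM /= conjcK opprB; ring.
Qed.

Lemma convDl a b c : bounded_mc a -> bounded_mc b -> bounded_mc c ->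
  conv (fun g => a g + b g) c = (fun g => conv a c g + conv b c g).
Proof.
move=> ba bb bc'; apply/funext => g; rewrite /conv -EcD; [|by bc..].
by apply: eq_Ec => h; rewrite mulrDl.
Qed.

Lemma convDr a b c : bounded_mc a -> bounded_mc b -> bounded_mc c ->
  conv c (fun g => a g + b g) = (fun g => conv c a g + conv c b g).
Proof.
move=> ba bb bc'; apply/funext => g; rewrite /conv -EcD; [|by bc..].
by apply: eq_Ec => h; rewrite mulrDr.
Qed.

Lemma convZl k a c : bounded_mc a -> bounded_mc c ->
  conv (fun g => k * a g) c = (fun g => k * conv a c g).
Proof.
move=> ba bc'; apply/funext => g; rewrite /conv -EcZ; last by bc.
by apply: eq_Ec => h; rewrite mulrA.
Qed.

Lemma convZr k a c : bounded_mc a -> bounded_mc c ->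
  conv c (fun g => k * a g) = (fun g => k * conv c a g).
Proof.
move=> ba bc'; apply/funext => g; rewrite /conv -EcZ; last by bc.
by apply: eq_Ec => h; rewrite mulrCA.
Qed.

Lemma convBl a b c : bounded_mc a -> bounded_mc b -> bounded_mc c ->
  conv (fun g => a g - b g) c = (fun g => conv a c g - conv b c g).
Proof.
move=> ba bb bc'; apply/funext => g; rewrite /conv -EcB; [|by bc..].
by apply: eq_Ec => h; rewrite mulrBl.
Qed.

Lemma convBr a b c : bounded_mc a -> bounded_mc b -> bounded_mc c ->
  conv c (fun g => a g - b g) = (fun g => conv c a g - conv c b g).
Proof.
move=> ba bb bc'; apply/funext => g; rewrite /conv -EcB; [|by bc..].
by apply: eq_Ec => h; rewrite mulrBr.
Qed.

Lemma Ec_conv a b : bounded_mc a -> bounded_mc b ->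
  Ec rho (conv a b) = Ec rho a * Ec rho b.
Proof.
move=> ba bb; rewrite /conv Ec_swap; last by bc.
rewrite -(@Ec_shift (fun h g => a (g - h) * b h)); last by bc.
rewrite -EcZ; last by bc.
apply: eq_Ec => h; rewrite -EcZr; last by bc.
by apply: eq_Ec => g; rewrite addrC addrA addNr add0r.
Qed.

Lemma conv_le a b g : bounded_mc a -> bounded_mc b ->
  sqmod (conv a b g) <= nrm (fun h => a (g - h)) * nrm b.
Proof.
move=> ba bb.
have -> : conv a b g = dot (fun h => a (g - h)) (fun h => (b h)^*%C).
  by apply: eq_Ec => h; rewrite conjcK.
have -> : nrm b = nrm (fun h => (b h)^*%C).
  by apply: eq_Er => h; rewrite sqmod_conj.
by apply: dot_CS; bc.
Qed.

(** Convolution by a bounded function takes L2 to L^oo; this turns the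
    convergence in mean of a sequence into the uniform convergence of its
    image. *)
Lemma conv_sup a : bounded_mc a -> exists2 K : R, 0 <= K &
  forall b g, bounded_mc b -> sqmod (conv a b g) <= K * nrm b.
Proof.
move=> ba; have [K K0 aK] := bmc_boundsqmod ba; exists K => // b g bb.
apply: le_trans (conv_le g ba bb) _; rewrite ler_wpM2r ?nrm2_ge0 //.
by apply: nrm2_le => //; bc.
Qed.

Lemma conv_null a n g : bounded_mc a -> bounded_mc n -> nrm n = 0 -> conv a n g = 0.
Proof.
move=> ba bn n0; have [K _ H] := conv_sup ba; apply: sqmod_eq0.
by have := H n g bn; rewrite n0 mulr0.
Qed.

(** Convolution by [a] has the kernel [a (g - h)], whose Hilbert-Schmidt norm is
    the L2 norm of [a] by translation invariance. *)
Lemma nrm_conv a b : bounded_mc a -> bounded_mc b ->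
  nrm (conv a b) <= nrm a * nrm b.
Proof.
move=> ba bb.
have bE : bounded_mc (fun g : Y => Ec rho (fun h => a (g - h) * (a (g - h))^*%C)) by bc.
have E : nrm a * nrm b = Er rho (fun g : Y => nrm (fun h => a (g - h)) * nrm b).
  apply: complexI; rewrite -Ec_real rmorphM /= nrm2E /dotc.
  rewrite -(@Ec_shift_subr (fun g : Y => a g * (a g)^*%C)); last by bc.
  rewrite -EcZr //; apply: eq_Ec => g; rewrite rmorphM /=; congr (_ * _).
  by rewrite nrm2E.
rewrite E; apply: le_Er.
- by apply: bmf_sqmod; exact: bmc_conv.
- apply: bmfM; last exact: bmf_cst.
  case: bE => bE _; rewrite (_ : (fun x => _) = (fun g : Y =>
    Re (Ec rho (fun h => a (g - h) * (a (g - h))^*%C)))) //.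
  apply/funext => g; apply: complexI.
  by rewrite nrm2E /dotc RRe_real // ger0_real // Ec_ge0 // => h; exact: mulcJ_ge0.
- by move=> g; exact: conv_le.
Qed.

Lemma uniform_cvg_convr a v e : bounded_mc a -> (forall j, bounded_mc (v j)) ->
  bounded_mc e -> uniform_cvg v e -> uniform_cvg (fun j => conv a (v j)) (conv a e).
Proof.
move=> ba bv be ve d d0; have [K K0 HK] := conv_sup ba.
have [N NP] := ve (d / (K + 1)) ltac:(by rewrite divr_gt0 // ltr_wpDl).
exists N => j Nj g.
have -> : conv a (v j) g - conv a e g = conv a (fun h => v j h - e h) g.
  by rewrite convBr.
apply: le_trans (HK _ g _) _; first by apply: bmcB.
have := nrm2_le rho (bmcB (bv j) be) (NP j Nj).
rewrite ler_pdivlMr ?ltr_wpDl // => H; apply: le_trans H.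
by rewrite mulrC ler_wpM2l ?nrm2_ge0 // lerDl.
Qed.

Lemma uniform_cvg_convl a v e : bounded_mc a -> (forall j, bounded_mc (v j)) ->
  bounded_mc e -> uniform_cvg v e -> uniform_cvg (fun j => conv (v j) a) (conv e a).
Proof.
move=> ba bv be ve d d0; have n0 := nrm2_ge0 rho a.
have [N NP] := ve (d / (nrm a + 1)) ltac:(by rewrite divr_gt0 // ltr_wpDl).
exists N => j Nj g; have bj := bv j.
have -> : conv (v j) a g - conv e a g = conv (fun h => v j h - e h) a g.
  by rewrite convBl.
apply: le_trans (conv_le g _ ba) _; first by apply: bmcB.
have H : nrm (fun h => v j (g - h) - e (g - h)) <= d / (nrm a + 1).
  by apply: nrm2_le => [|h]; [bc|exact: NP].
apply: (@le_trans _ _ (d / (nrm a + 1) * nrm a)); first by rewrite ler_wpM2r.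
by rewrite mulrAC ler_pdivrMr ?ltr_wpDl // ler_wpM2l ?ltW // ltrDl.
Qed.

Lemma uniform_cvg_star v e : uniform_cvg v e -> uniform_cvg (fun j => star (v j)) (star e).
Proof.
move=> ve d d0; have [N NP] := ve d d0; exists N => j Nj g.
by rewrite /star -rmorphB sqmod_conj NP.
Qed.

Opaque Ec Er.

(** * Power iteration *)
Section PowerIteration.
Variable k : Y -> R[i].
Hypotheses (bk : bounded_mc k) (hk : star k = k) (k2 : 0 < nrm (conv k k)).

Let pw n := iter n (conv k) k.
Let c n := nrm (pw n).

Let pwS n : pw n.+1 = conv k (pw n). Proof. by []. Qed.

Let bmc_pw n : bounded_mc (pw n).
Proof. by elim: n => //= n IH; bc. Qed.
Hint Resolve bmc_pw bk : core.

Let star_pw n : star (pw n) = pw n.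
Proof. by elim: n => [//|n IH]; rewrite pwS star_conv // IH hk. Qed.

Let pw_conv i j : conv (pw i) (pw j) = pw (i + j).+1.
Proof.
elim: i => [|i IH]; first by rewrite add0n pwS.
by rewrite pwS (convA bk (bmc_pw i) (bmc_pw j)) IH.
Qed.

Let dot_pw i j : dot (pw i) (pw j) = dot k (pw (i + j)%N).
Proof.
elim: i j => [|i IH] j; first by rewrite add0n.
by rewrite pwS (dot_conv bk (bmc_pw i) (bmc_pw j)) hk -pwS IH addnS.
Qed.

Let dot_pw_c i j n : (i + j = n.*2)%N -> dot (pw i) (pw j) = (c n)%:C%C.
Proof. by move=> ij; rewrite /c nrm2E !dot_pw ij addnn. Qed.

(** [c] is log-convex by the Cauchy-Schwarz inequality, because [k] is
    self-adjoint, and submultiplicative because convolution is. *)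
Let growth : exists2 s : R, 0 < s & forall n, c n.+1 <= s * c n /\ s ^+ n.+1 <= c n.
Proof.
apply: log_convex_growth.
- by move=> n; exact: nrm2_ge0.
- exact: k2.
- move=> n; rewrite -sqmod_real -(@dot_pw_c n n.+2); first exact: dot_CS.
  by rewrite !addnS addnn doubleS.
- by move=> i j; rewrite /c -pw_conv; exact: nrm_conv.
Qed.

(** [e] is the spectral projection onto the top eigenspace of the convolution by
    [conv k k], obtained as the limit of the powers of [conv k k] divided by
    those of its top eigenvalue [s].  The inner products of two such powers
    depend only on the sum of the exponents and decrease to a positive limit,
    which makes them a Cauchy sequence.  The last three properties pass from [k]
    to its powers and to the limit. *)
Lemma top_idempotent : exists e : Y -> R[i], exists2 s : R, 0 < s &
  [/\ bounded_mc e, star e = e, conv e e = e & 0 < nrm e] /\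
  [/\ conv (conv k k) e = (fun g => s%:C%C * e g),
      forall p, bounded_mc p -> conv p k = k -> conv p e = e,
      forall p, bounded_mc p -> conv k p = k -> conv e p = e &
      Ec rho k = 0 -> Ec rho e = 0].
Proof.
have [s s0 cs] := growth.
(* [pw j.*2.+1] is the power of exponent [j.+1] of [conv k k]. *)
pose q j : R[i] := (s ^- j.+1)%:C%C.
pose v j : Y -> R[i] := fun g => q j * pw (j.*2.+1) g.
have bv j : bounded_mc (v j) by apply: bmcM; [exact: bmc_cst|].
pose b n := c n / s ^+ n.+1.
have sn n : 0 < s ^+ n by rewrite exprn_gt0.
have b1 n : 1 <= b n by rewrite /b ler_pdivlMr // mul1r; case: (cs n).
have bS n : b n.+1 <= b n.
  rewrite /b ler_pdivrMr // [s ^+ n.+2]exprS mulrCA divfK ?gt_eqF //.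
  by case: (cs n).
have bmono n m : (n <= m)%N -> b m <= b n.
  by apply: (homo_leq (r := fun x y : R => y <= x)) => // y x z yx zy; exact: le_trans zy yx.
have bcvg : cvgn b.
  apply: nonincreasing_is_cvgn => //.
  by exists 1 => _ [n _ <-].
set be := limn b.
have bge n : be <= b n by exact: nonincreasing_cvgn_ge.
have bsmall (e : R) : 0 < e -> exists N, b N - be <= e.
  move=> e0; have /cvgrPdist_le /(_ e e0) [N _ H] := bcvg.
  exists N; have := H N (leqnn N); rewrite distrC ger0_norm ?subr_ge0 //.
have dv i j : dot (v i) (v j) = (b (i + j).+1)%:C%C.
  rewrite /v dotcZl // ?dotcZr //; last by apply: bmcM; [exact: bmc_cst|].
  rewrite (@dot_pw_c _ _ (i + j).+1); last by rewrite !addSn !addnS -!doubleD doubleS.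
  rewrite /q conjc_real -!rmorphM /=; congr (_%:C%C).
  by rewrite /b mulrA mulrC -invfM -exprD addSn addnS.
have nv i : nrm (v i) = b i.*2.+1.
  by apply: complexI; rewrite nrm2E dv addnn.
have qM i j : q i * q j = q (i.+1 + j)%N.
  by rewrite /q -rmorphM /= -invfM -exprD addSn addnS addSn.
have vv i j : conv (v i) (v j) = v (i.+1 + j)%N.
  rewrite /v convZl // ?convZr //; last by apply: bmcM; [exact: bmc_cst|].
  apply/funext => g; rewrite mulrA qM pw_conv; congr (_ * pw _ g).
  by rewrite !addSn !addnS -!doubleD doubleS.
have Cv (e : R) : 0 < e -> exists N, forall i j, (N <= i)%N -> (N <= j)%N ->
     forall x, sqmod (v i x - v j x) <= e.
  move=> e0; have [K K0 HK] := conv_sup (bv 0%N).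
  have [N HN] := bsmall (e / (2 * K + 1)) ltac:(by rewrite divr_gt0 // ltr_wpDl // mulr_ge0).
  exists N.+1 => -[//|i] [//|j]; rewrite !ltnS => Ni Nj x.
  (* Convergence in mean becomes uniform after one more convolution. *)
  have E l : v l.+1 = conv (v 0%N) (v l) by rewrite vv.
  rewrite !E -[_ - _]/((fun g => conv (v 0%N) (v i) g - conv (v 0%N) (v j) g) x) -convBr //.
  apply: le_trans (HK _ _ (bmcB (bv i) (bv j))) _.
  rewrite nrm2B // !nv dv /=.
  apply: (@le_trans _ _ (K * (2 * (b N - be)))).
    rewrite ler_wpM2l //.
    have h1 : b i.*2.+1 <= b N by apply: bmono; rewrite (leq_trans Ni) // -addnn leqW // leq_addr.
    have h2 : b j.*2.+1 <= b N by apply: bmono; rewrite (leq_trans Nj) // -addnn leqW // leq_addr.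
    by have h3 := bge (i + j).+1; lra.
  have B0 : 0 <= b N - be by rewrite subr_ge0.
  move: HN; rewrite ler_pdivlMr ?ltr_wpDl // ?mulr_ge0 // => HN.
  have -> : K * (2 * (b N - be)) = (b N - be) * (2 * K + 1) - (b N - be) by ring.
  by lra.
have [e bE ve] := uniform_limit bv Cv.
have vconv i : conv (v i) e = e.
  apply: (@uniform_cvg_uniq _ _ _ (fun j => conv (v i) (v j))); first exact: uniform_cvg_convr.
  rewrite (_ : (fun j => _) = (fun j => v (i.+1 + j)%N)); last exact/funext.
  exact: uniform_cvg_shift.
have ee : conv e e = e.
  apply: (@uniform_cvg_uniq _ _ _ (fun j => conv (v j) e)); first exact: uniform_cvg_convl.
  rewrite (_ : (fun j => _) = (fun j => e)); last exact/funext.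
  by move=> d d0; exists 0%N => j _ g; rewrite subrr sqmod_real expr0n ltW.
have closed (T : (Y -> R[i]) -> Y -> R[i]) : uniform_cvg (fun j => T (v j)) (T e) ->
    (forall j, T (v j) = v j) -> T e = e.
  move=> Te Tv; apply: (uniform_cvg_uniq Te).
  by rewrite (_ : (fun j => _) = v); [exact: ve|apply/funext].
exists e, s => //; split; [split => //|split].
- apply: (closed star); first exact: uniform_cvg_star.
  move=> j; apply/funext => g; rewrite /star /v rmorphM; congr (_ * _); first exact: conjc_real.
  exact: (congr1 (fun a => a g) (star_pw j.*2.+1)).
- rewrite lt_def nrm2_ge0 andbT; apply/eqP => e0.
  have E0 : e = fun=> 0.
    by rewrite -ee; apply/funext => g; exact: conv_null.
  have [N NP] := ve (1 / 2) ltac:(by []).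
  have vN x : sqmod (v N x) <= 1 / 2 by have := NP N (leqnn N) x; rewrite E0 subr0.
  have := nrm2_le rho (bv N) vN; rewrite nv => H; have := b1 N.*2.+1; lra.
- have := vconv 0%N; rewrite /v /= convZl //; last exact: bmc_conv.
  move=> H; apply/funext => g.
  rewrite -[in RHS]H /q mulrA -rmorphM /= expr1 divff ?mul1r // gt_eqF //.
- move=> p bp pk; apply: closed; first exact: uniform_cvg_convr.
  have pp n : conv p (pw n) = pw n.
    by case: n => //= n; rewrite -convA // pk.
  by move=> j; rewrite /v convZr // pp.
- move=> p bp kp; apply: (closed (fun x => conv x p)); first exact: uniform_cvg_convl.
  have pp n : conv (pw n) p = pw n.
    by elim: n => //= n IH; rewrite convA // IH.
  by move=> j; rewrite /v convZl // pp.
- move=> k0; apply: (uniform_cvg_Ec0 bv bE ve) => j; rewrite /v EcZ // /= Ec_conv // k0.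
  by rewrite mul0r mulr0.
Qed.

End PowerIteration.

(** * Minimal idempotents are characters *)
Definition idempotent (p : Y -> R[i]) :=
  [/\ bounded_mc p, star p = p, conv p p = p, Ec rho p = 0 & 0 < nrm p].

Lemma idempotent_ge1 p : idempotent p -> 1 <= nrm p.
Proof.
case=> bp _ pp _ p0; have := nrm_conv bp bp.
by rewrite pp -[leLHS]mul1r ler_pM2r.
Qed.

Lemma idempotentB p e : idempotent p -> idempotent e -> conv p e = e -> conv e p = e ->
  (fun g => p g - e g) = (fun=> 0) \/
  idempotent (fun g => p g - e g) /\ nrm (fun g => p g - e g) = nrm p - nrm e.
Proof.
move=> [bp sp pp p0 np] [be se ee e0 ne] pe ep.
set q := fun g => p g - e g.
have bq : bounded_mc q by exact: bmcB.
have qq : conv q q = q.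
  rewrite /q convBl ?convBr // pp pe ep ee.
  by apply/funext => g; rewrite subrr subr0.
have nq : nrm q = nrm p - nrm e.
  rewrite /q nrm2B // (_ : dot p e = (nrm e)%:C%C) /=; first by ring.
  have : dot (conv e p) e = dot p e by rewrite dot_conv // se ee.
  by rewrite ep nrm2E => <-.
have [n0|n0] := eqVneq (nrm q) 0.
  by left; rewrite -qq; apply/funext => g; exact: conv_null.
right; split=> //; split=> //.
- apply/funext => g; rewrite /q /star rmorphB.
  congr (_ - _); first by rewrite -[RHS](congr1 (fun a => a g) sp).
  by rewrite -[RHS](congr1 (fun a => a g) se).
- by rewrite /q EcB // p0 e0 subrr.
- by rewrite lt_def n0 nrm2_ge0.
Qed.

Section MinimalIdempotent.
Variable k : Y -> R[i].
Hypotheses (bk : bounded_mc k) (hk : star k = k) (k0 : Ec rho k = 0)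
  (k2 : 0 < nrm (conv k k)).

(** Splitting off a proper part [e] of an idempotent [p] lowers the squared norm by
    that of [e], which is at least [1].  So [p] is minimal as soon as its
    squared norm exceeds the infimum by less than [1]. *)
Lemma minimal_idempotent : exists2 p, idempotent p &
  forall e, idempotent e -> conv p e = e -> conv e p = e -> p = e.
Proof.
pose S := [set x : R | exists2 p, idempotent p & nrm p = x].
have S1 x : S x -> 1 <= x by case=> p ip <-; exact: idempotent_ge1.
have hS : has_inf S.
  split; last by exists 1 => x /S1.
  have [e [s s0 [[be se ee ne] [_ _ _ ke]]]] := top_idempotent bk hk k2.
  by exists (nrm e); exists e => //; split=> //; exact: ke.
have [_ [p ip <-] pinf] := inf_adherent ltr01 hS.
exists p => // e ie pe ep.
have [q0|[iq nq]] := idempotentB ip ie pe ep.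
  by apply/funext => g; have := congr1 (fun a => a g) q0 => /eqP; rewrite subr_eq0 => /eqP.
have qS : inf S <= nrm p - nrm e.
  by rewrite -nq; apply: ge_inf; [case: hS|exists (fun g => p g - e g)].
have := idempotent_ge1 ie.
move: (inf S) (nrm p) (nrm e) qS pinf => x y z; rewrite -[x + 1]/(x + 1 : R).
by move=> h1 h2 h3; exfalso; have := lerD h1 h3; rewrite subrK leNgt h2.
Qed.

Section OneDimensional.
Variable p : Y -> R[i].
Hypotheses (ip : idempotent p)
  (pmin : forall e, idempotent e -> conv p e = e -> conv e p = e -> p = e).

Let bp : bounded_mc p. Proof. by case: ip. Qed.
Let sp : star p = p. Proof. by case: ip. Qed.
Let pp : conv p p = p. Proof. by case: ip. Qed.
Let p0 : Ec rho p = 0. Proof. by case: ip. Qed.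
Let np : 0 < nrm p. Proof. by case: ip. Qed.

(** The self-adjoint elements of mean zero of the algebra [p * A * p]. *)
Definition in_corner a :=
  [/\ bounded_mc a, star a = a, conv p a = a, conv a p = a & Ec rho a = 0].

(** Unless [conv a a] is null, the top idempotent of [a] lies in the corner of [p];
    it is then [p] itself by minimality, and [conv a a] acts on it as a scalar. *)
Lemma corner_sqr a : in_corner a -> exists s : R[i], conv a a = (fun g => s * p g).
Proof.
move=> [ba sa pa ap a0].
have [n0|n0] := eqVneq (nrm (conv a a)) 0.
  exists 0; have -> : conv a a = conv p (conv a a) by rewrite -convA // pa.
  apply/funext => g; rewrite mul0r; apply: conv_null; [exact: bp|exact: bmc_conv|exact: n0].
have npos : 0 < nrm (conv a a) by rewrite lt_def n0 nrm2_ge0.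
have [e [s s0 [[be se ee ne] [ae pe ep e0]]]] := top_idempotent ba sa npos.
have pE : p = e.
  by apply: pmin; [split=> //; exact: e0|exact: pe|exact: ep].
exists s%:C%C; rewrite pE -ae -pE convA ?ap //; exact: bmc_conv.
Qed.

(** Squares are scalar multiples of [p], so [a = ((a + p)^2 - a^2 - p) / 2] is one
    too. *)
Lemma corner_scalar a : in_corner a -> exists s : R[i], a = (fun g => s * p g).
Proof.
move=> ca; have [ba sa pa ap a0] := ca.
have [s Hs] := corner_sqr ca.
have bap : bounded_mc (fun g => a g + p g) by exact: bmcD.
have cap : in_corner (fun g => a g + p g).
  split=> //.
  - apply/funext => g; rewrite /star rmorphD.
    congr (_ + _); first by rewrite -[RHS](congr1 (fun a => a g) sa).
    by rewrite -[RHS](congr1 (fun a => a g) sp).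
  - by rewrite convDr // pa pp.
  - by rewrite convDl // ap pp.
  - by rewrite EcD // a0 p0 addr0.
have [s' Hs'] := corner_sqr cap.
exists ((s' - s - 1) / 2); apply/funext => g.
have := congr1 (fun a => a g) Hs'.
rewrite convDl // !convDr // ap pa pp Hs => H.
have -> : a g = ((s * p g + a g + (a g + p g)) - s * p g - p g) / 2 by field.
by rewrite [s * p g + a g + (a g + p g)]H; field.
Qed.

Definition translate h (a : Y -> R[i]) : Y -> R[i] := fun g => a (g + h).

(** Convolution commutes with translations, so [p * p(. + h)] is in the algebra
    [p * A * p]; its self-adjoint and anti-self-adjoint parts are scalar
    multiples of [p]. *)
Lemma conv_translate h : exists s : R[i],
  conv p (translate h p) = (fun g => s * p g).
Proof.
pose b x := conv p (translate x p).
have bt x : bounded_mc (translate x p) by rewrite /translate; bc.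
have bb x : bounded_mc (b x) by exact: bmc_conv.
have sb x : star (b x) = b (- x).
  rewrite /b star_conv // sp; congr (conv _ _); apply/funext => g.
  by rewrite /star /translate -[in RHS]sp /star opprD opprK.
have pb x : conv p (b x) = b x by rewrite /b -convA // pp.
have bpE x : conv (b x) p = b x.
  rewrite /b convA //; congr (conv _ _); apply/funext => g.
  rewrite /translate -[in RHS]pp /conv; apply: eq_Ec => y.
  by rewrite addrAC.
have b0 x : Ec rho (b x) = 0 by rewrite /b Ec_conv // p0 mul0r.
have sbE x g : (b x (- g))^*%C = b (- x) g.
  exact: (congr1 (fun a => a g) (sb x)).
have [r1 H1] : exists s : R[i], (fun g => b h g + b (- h) g) = (fun g => s * p g).
  apply: corner_scalar; split.
  - exact: bmcD.
  - by apply/funext => g; rewrite /star rmorphD /= !sbE opprK addrC.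
  - by rewrite convDr // !pb.
  - by rewrite convDl // !bpE.
  - by rewrite EcD // !b0 addr0.
have bi : bounded_mc (fun g => b h g - b (- h) g) by exact: bmcB.
have [r2 H2] : exists s : R[i], (fun g => 'i%C * (b h g - b (- h) g)) = (fun g => s * p g).
  apply: corner_scalar; split.
  - by apply: bmcM; [exact: bmc_cst|].
  - apply/funext => g; rewrite /star rmorphM rmorphB /= !sbE opprK.
    rewrite (_ : (0 -i* 1)%C = - 'i%C); last by apply/eqP; rewrite eq_complex /= oppr0 !eqxx.
    by ring.
  - by rewrite convZr // convBr // !pb.
  - by rewrite convZl // convBl // !bpE.
  - by rewrite EcZ // EcB // !b0 subrr mulr0.
exists ((r1 - 'i%C * r2) / 2); apply/funext => g.
have E1 := congr1 (fun a => a g) H1; have E2 := congr1 (fun a => a g) H2.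
have -> : (r1 - 'i%C * r2) / 2 * p g = (r1 * p g - 'i%C * (r2 * p g)) / 2 by field.
rewrite -[r1 * _]E1 -[r2 * _]E2 -/(b h).
rewrite (_ : _ - _ = 2 * b h g); first by field.
have i2 : 'i%C * 'i%C = -1 :> R[i] by rewrite -expr2 sqr_i.
rewrite mulrA i2; ring.
Qed.

Let w : R[i] := (nrm p)%:C%C.

(** The scalar of the preceding lemma, found by pairing with [p]. *)
Lemma conv_translateE h g : w * conv p (translate h p) g = p h * p g.
Proof.
have bt x : bounded_mc (translate x p) by rewrite /translate; bc.
have [s Hs] := conv_translate h.
suff -> : p h = s * w by rewrite Hs; ring.
have : dot (conv p (translate h p)) p = s * w.
  by rewrite Hs dotcZl // /w nrm2E.
move=> <-; rewrite dot_conv // sp pp /dotc.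
transitivity (Ec rho (fun y => p (h - y) * p y)).
  by rewrite -[in LHS]pp.
rewrite -[LHS]Ec_opp; last by bc.
apply: eq_Ec => y; rewrite opprK /translate addrC; congr (_ * _).
by rewrite -[in LHS]sp /star opprK.
Qed.

(** Both sides have the same integral against every bounded [c].  They need not
    agree for every [h], since [rho] is only invariant under its own
    translations on average. *)
Lemma conv_translate_ae g : {ae rho, forall h, conv p (translate h p) g = p (g + h)}.
Proof.
pose D h := conv p (translate h p) g - p (g + h).
have bD1 : bounded_mc (fun h => conv p (translate h p) g).
  by rewrite /conv /translate; bc.
have bD2 : bounded_mc (fun h => p (g + h)) by bc.
have bD : bounded_mc D by exact: bmcB.
have E c : bounded_mc c ->
    Ec rho (fun h => conv p (translate h p) g * c h) = Ec rho (fun h => p (g + h) * c h).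
  move=> bc'; rewrite /translate.
  transitivity (Ec rho (fun h => Ec rho (fun y => p (g - (h + y - h)) * p (h + y) * c h))).
    apply: eq_Ec => h; rewrite /conv -EcZr; last by bc.
    by apply: eq_Ec => y; rewrite [h + y]addrC addrK.
  rewrite (@Ec_shift (fun h y => p (g - (y - h)) * p y * c h)); last by bc.
  apply: eq_Ec => h; rewrite EcZr; last by bc.
  congr (_ * _); rewrite -[in RHS]pp /conv; apply: eq_Ec => y.
  by rewrite opprB addrA.
have D0 : dotc rho D D = 0.
  rewrite dotcBl // /dotc E ?subrr //; exact: bmc_conj.
by apply: filterS (dotc_eq0 bD D0) => h /eqP; rewrite subr_eq0 => /eqP.
Qed.

Lemma idempotent_mult g : {ae rho, forall h, w * p (g + h) = p h * p g}.
Proof.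
by apply: filterS (conv_translate_ae g) => h <-; rewrite conv_translateE.
Qed.

Lemma multiplicative_mean (f : Y -> R[i]) : bounded_mc f ->
  (forall g, {ae rho, forall h, f (g + h) = f h * f g}) ->
  Ec rho f = Ec rho f * Ec rho f.
Proof.
move=> bf fM; rewrite -[LHS]Ec_shift_add // -EcZ //.
apply: eq_Ec => g; rewrite -EcZr //; apply: Ec_ae; [by bc|by bc|].
exact: fM.
Qed.

(** [|p|^2 / w^2] is multiplicative and has mean [1 / w], so [1 / w] is a nonzero
    idempotent. *)
Lemma minimal_nrm1 : nrm p = 1.
Proof.
have w0 : w != 0.
  by rewrite /w; apply: contraTneq np => /complexI ->; rewrite ltxx.
have wc : w^*%C = w by rewrite /w conjc_real.
pose f g := p g * (p g)^*%C / w ^+ 2.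
have bf : bounded_mc f by rewrite /f; bc.
have Ef : Ec rho f = w^-1.
  rewrite /f EcZr; last by bc.
  by rewrite -[Ec rho _]/(dotc rho p p) -nrm2E -/w; field.
have : Ec rho f = Ec rho f * Ec rho f.
  apply: multiplicative_mean => // g; apply: filterS (idempotent_mult g) => h H.
  rewrite /f (_ : p (g + h) = w^-1 * (p h * p g)); last by rewrite -H mulKf.
  have wVc : (w^-1)^*%C = w^-1 by rewrite conjc_inv wc.
  rewrite !rmorphM [X in _ * (X * _) / _]wVc; by field.
rewrite Ef => H; apply: complexI; rewrite -/w.
have /(congr1 GRing.inv) : w^-1 = 1 by apply: (mulfI (invr_neq0 w0)); rewrite mulr1 -H.
by rewrite invrK invr1 => ->.
Qed.

(** [|p|^4] is multiplicative, so its mean, which is at least the square of the mean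
    [1] of [|p|^2], is [1].  Thus [|p|^2] has variance [0]. *)
Lemma minimal_character :
  (forall g, {ae rho, forall h, p (g + h) = p g * p h}) /\
  {ae rho, forall g, sqmod (p g) = 1}.
Proof.
have w1 : w = 1 by rewrite /w minimal_nrm1.
have pM g : {ae rho, forall h, p (g + h) = p g * p h}.
  by apply: filterS (idempotent_mult g) => h; rewrite w1 mul1r mulrC.
split=> //.
pose A g := p g * (p g)^*%C.
have bA : bounded_mc A by rewrite /A; bc.
have EA : Ec rho A = 1 by rewrite -[LHS]nrm2E -/w w1.
pose f g := A g * A g.
have bf : bounded_mc f by rewrite /f; bc.
have Ef2 : Ec rho f = Ec rho f * Ec rho f.
  apply: multiplicative_mean => // g; apply: filterS (pM g) => h H.
  by rewrite /f /A H !rmorphM /=; ring.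
have Ac g : (A g)^*%C = A g by rewrite /A -sqmodE conjc_real.
have Ef1 : 1 <= Ec rho f.
  have := Ec_norm_le1 rho bA; rewrite EA normr1 expr1n.
  by rewrite /dotc; under eq_Ec do rewrite Ac.
have Ef : Ec rho f = 1.
  have fn0 : Ec rho f != 0 by rewrite gt_eqF // (lt_le_trans ltr01).
  by apply: (mulfI fn0); rewrite mulr1 -Ef2.
have bA1 : bounded_mc (fun g => A g - 1) by bc.
have : dotc rho (fun g => A g - 1) (fun g => A g - 1) = 0.
  rewrite /dotc; transitivity (Ec rho (fun g => f g - (A g + A g - 1))).
    apply: eq_Ec => g.
    have -> : (A g - 1)^*%C = A g - 1 by rewrite rmorphB [X in X - _]Ac [X in _ - X]conjc1.
    by rewrite /f; ring.
  rewrite EcB // ?EcB ?EcD ?Ec_cst ?EA ?Ef //; try by bc.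
  by ring.
move=> /(dotc_eq0 bA1); apply: filterS => g /eqP; rewrite subr_eq0 => /eqP.
by rewrite /A -sqmodE => /complexI.
Qed.

End OneDimensional.

Theorem character_of_kernel : exists u : Y -> R[i],
  [/\ bounded_mc u, Ec rho u = 0,
     forall g, {ae rho, forall h, u (g + h) = u g * u h} &
     {ae rho, forall g, sqmod (u g) = 1}].
Proof.
have [p ip pmin] := minimal_idempotent.
have [pM p1] := minimal_character ip pmin.
by exists p; split=> //; case: ip.
Qed.

End MinimalIdempotent.

(** * A kernel of mean zero *)

Definition indc (A : set Y) : Y -> R[i] := fun g => (\1_A g)%:C%C.

Lemma bmc_indc (A : set Y) : measurable A -> bounded_mc (indc A).
Proof. by move=> mA; exact: (bmc_real (bmf_indic R mA)). Qed.

Lemma Ec_indc (A : set Y) : measurable A -> Ec rho (indc A) = (fine (rho A))%:C%C.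
Proof. by move=> mA; rewrite /indc Ec_real Er_indic. Qed.

(** The kernel is the centred indicator of [V].  If [k * k] were null then so
    would be [k * 1_C]; but [k] takes the positive value [1 - rho V] on the
    differences of elements of [C]. *)
Lemma exists_kernel (V C : set Y) : measurable V -> measurable C ->
  (forall g, V g -> V (- g)) -> (forall g h, C g -> C h -> V (g - h)) ->
  (rho V < 1)%E -> (0 < rho C)%E ->
  exists k : Y -> R[i], [/\ bounded_mc k, star k = k, Ec rho k = 0 &
    0 < nrm (conv k k)].
Proof.
move=> mV mC sV CV V1 C0.
set r := fine (rho V).
have bV := bmc_indc mV; have bC := bmc_indc mC.
pose k g := indc V g - r%:C%C.
have bk : bounded_mc k by apply: bmcB => //; exact: bmc_cst.
have hk : star k = k.
  have kE g : k g = (\1_V g - r)%:C%C by rewrite /k /indc -rmorphB.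
  apply/funext => g; rewrite /star !kE conjc_real !indicE.
  have -> // : (- g \in V) = (g \in V).
  by apply/idP/idP; rewrite !inE => /sV //; rewrite opprK.
have r1 : r < 1.
  by rewrite /r -lte_fin fineK // fin_num_measure.
have c0 : 0 < fine (rho C).
  by rewrite -lte_fin fineK // fin_num_measure.
exists k; split=> //.
  by rewrite /k EcB // ?Ec_cst ?Ec_indc ?subrr //; exact: bmc_cst.
rewrite lt_def nrm2_ge0 andbT; apply/eqP => kk0.
set a := indc C.
have ka0 : nrm (conv k a) = 0.
  have bka := bmc_conv bk bC; have bkk := bmc_conv bk bk.
  apply: complexI; rewrite nrm2E dot_conv // hk -convA //.
  have n0 : nrm (conv (conv k k) a) = 0.
    apply/eqP; rewrite eq_le nrm2_ge0 andbT.
    by have := nrm_conv bkk bC; rewrite kk0 mul0r.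
  by apply: sqmod_eq0; have := dot_CS rho bC (bmc_conv bkk bC); rewrite n0 mulr0.
have : dot (conv k a) a = ((1 - r) * fine (rho C) * fine (rho C))%:C%C.
  transitivity (Ec rho (fun g => (1 - r)%:C%C * (Ec rho a) * a g)).
    apply: eq_Ec => g; rewrite /conv.
    have ac x : (a x)^*%C = a x by rewrite /a /indc conjc_real.
    rewrite ac -EcZr; last by bc.
    rewrite -EcZ // -EcZr; last by bc.
    apply: eq_Ec => h; rewrite /k /a /indc !indicE.
    have [gC|] := boolP (g \in C); last by rewrite !mulr0.
    have [hC|] := boolP (h \in C); last by rewrite !(mulr0, mul0r).
    have -> : g - h \in V by rewrite inE; apply: CV; [move: gC|move: hC]; rewrite inE.
    by rewrite !mulr1 rmorphB.
  by rewrite EcZ // Ec_indc // -!rmorphM.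
have := dot_CS rho (bmc_conv bk bC) bC; rewrite ka0 mul0r => /sqmod_eq0 -> /esym /complexI.
apply/eqP; rewrite gt_eqF //.
by rewrite !mulr_gt0 // subr_gt0.
Qed.

End Convolution.

(** * The Borel structure of a compact metrizable group *)

Lemma countable_base (R : realType) (G : topologicalZmodType) :
  compact [set: G] -> metrizable R G ->
  exists b : nat -> set G, (forall n, open (b n)) /\
    forall (x : G) (V : set G), nbhs x V -> exists2 n, b n x & b n `<=` V.
Proof.
move=> cG [M [f [g [fK gK cf cg]]]].
pose M' : pseudoPMetricType R :=
  HB.pack (Metric.sort M) (isPointed.Build (Metric.sort M) (f 0)).
have cM : compact [set: M'].
  have -> : [set: M'] = f @` [set: G].
    by apply/seteqP; split=> // y _; exists (g y) => //; exact: gK.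
  by apply: continuous_compact => //; exact: continuous_subspaceT.
have [B cB [oB bB]] := compact_second_countable cM.
have /pcard_leP/unsquash j := cB.
pose P n U := B U /\ j U = n.
pose b n : set G := if pselect (exists U, P n U) is left h then f @^-1` (projT1 (cid h)) else set0.
exists b; split.
  move=> n; rewrite /b; case: pselect => [h|_]; last exact: open0.
  by case: cid => U [BU _] /=; apply: open_comp; [move=> y _; exact: cf|exact: oB].
move=> x V xV.
have : nbhs (f x) (g @^-1` V) by apply: cg; rewrite fK.
move=> /bB [U [BU Ufx] UV].
exists (j U); rewrite /b; case: pselect => [h|nh].
- case: cid => W [BW jW] /=; have -> // : W = U.
  by apply: (@inj _ _ _ j) => //; rewrite inE.
- by case: nh; exists U.
- case: cid => W [BW jW] /= y.
  have -> : W = U by apply: (@inj _ _ _ j) => //; rewrite inE.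
  by move=> /= /UV; rewrite /= fK.
- by case: nh; exists U.
Qed.

Section Topology.
Context (R : realType) (G : topologicalZmodType).
Notation Y := (borelG G).
Variable b : nat -> set G.
Hypotheses (ob : forall n, open (b n))
  (bb : forall (x : G) (V : set G), nbhs x V -> exists2 n, b n x & b n `<=` V).

Lemma open_borelG (U : set G) : open U -> measurable (U : set Y).
Proof. by move=> oU; apply: sub_sigma_algebra. Qed.

(** The countable base makes the preimage of an open set a countable union of open
    rectangles, so that continuity of the subtraction implies measurability for
    the product of the Borel sigma-algebras. *)
Lemma sub_borelG_measurable : measurable_fun setT (fun p : Y * Y => p.1 - p.2).
Proof.
apply: (measurability (@open G : set (set Y))) => //.
move=> _ [U oU <-]; rewrite setTI.
pose good n m := `[< forall x y, b n x -> b m y -> U (x - y) >].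
have -> : (fun p : Y * Y => p.1 - p.2) @^-1` U =
    \bigcup_n \bigcup_(m in [set m | good n m]) (b n `*` b m).
  apply/seteqP; split=> [[x y] /= Uxy|[x y] [n _ [m /asboolP gnm] [/= bx by']]]; last exact: gnm.
  have /(_ (x, y)) := @sub_continuous G.
  move=> /(_ U); rewrite /= => H.
  have : nbhs (x - y) U by apply: open_nbhs_nbhs.
  move=> /H [[A C] /= [xA yC] ACU].
  have [n bnx nA] := bb xA; have [m bmy mC] := bb yC.
  exists n => //; exists m => //=; apply/asboolP => x' y' /nA Ax' /mC Cy'.
  exact: (ACU (x', y')).
apply: bigcup_measurable => n _; apply: bigcup_measurable => m _.
by apply: measurableX; exact: open_borelG.
Qed.

(** Countably many null sets do not cover. *)
Lemma base_positive (rho : probability Y R) (Q : set (set G)) :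
  (forall x : G, exists2 n, b n x & Q (b n)) ->
  exists2 n, Q (b n) & (0 < rho (b n))%E.
Proof.
move=> H; apply: contrapT => N.
have n0 n : Q (b n) -> rho (b n) = 0%E.
  move=> Qn; apply/eqP; rewrite eq_le measure_ge0 andbT leNgt; apply/negP => r0.
  by apply: N; exists n.
have : rho [set: Y] = 0%E.
  pose c n : set Y := if `[< Q (b n) >] then b n else set0.
  have -> : [set: Y] = \bigcup_n c n.
    apply/seteqP; split=> // x _; have [n bx Qn] := H x.
    by exists n => //; rewrite /c asboolT.
  have cN n : rho.-negligible (c n).
    rewrite /c; case: asboolP => [Qn|_]; last exact: negligible_set0.
    by apply/negligibleP; [exact: open_borelG|exact: n0].
  apply/negligibleP; last exact: negligible_bigcup.
  apply: bigcup_measurable => n _; rewrite /c.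
  by case: asboolP => // _; exact: open_borelG.
rewrite probability_setT => /eqP; by rewrite onee_eq0.
Qed.

End Topology.

(** * A multiplicative function from the joining *)
Section Law.
Context (R : realType) (G : topologicalZmodType) d (X : measurableType d).
Notation Y := (borelG G).
Variables (mu : probability X R) (lambda : probability (X * X * X)%type R).
Hypothesis hindep : pairwise_independent_marginals mu lambda.
Hypothesis hmarg : forall A : set X, measurable A ->
  [/\ pushforward lambda (fun p => p.1.1) A = mu A,
      pushforward lambda (fun p => p.1.2) A = mu A &
      pushforward lambda (fun p => p.2) A = mu A].
Hypothesis cG : compact [set: G].
Hypothesis mG : metrizable R G.
Variable xi : X -> G.
Hypothesis hxi : borel_measurable xi.
Hypothesis hnonconst : ~ exists c : G, {ae mu, forall x, xi x = c}.
Hypothesis hsum : {ae lambda, forall p : X * X * X, xi p.2 = xi p.1.1 + xi p.1.2}.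

Let mxi : measurable_fun setT (xi : X -> Y).
Proof. by move=> _ B mB; rewrite setTI; exact: hxi. Qed.

Let law : exists rho : probability Y R, forall A : set Y, measurable A -> mu (xi @^-1` A) = rho A.
Proof.
pose rv : {mfun X >-> Y} := mfun_Sub (mem_set mxi).
by exists (distribution mu rv).
Qed.

Lemma Ec_lambda12 (F : X * X -> R[i]) : bounded_mc F ->
  Ec lambda (fun p => F (p.1.1, p.1.2)) = Ec mu (fun x => Ec mu (fun y => F (x, y))).
Proof.
move=> bF; rewrite Ec_prod //.
apply: (Ec_comp (m := fun p : X * X * X => (p.1.1, p.1.2))) => //.
- apply: measurable_fun_pair; exact: measurableT_comp.
- by move=> A mA; have [] := hindep mA.
Qed.

Lemma Ec_lambda13 (F : X * X -> R[i]) : bounded_mc F ->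
  Ec lambda (fun p => F (p.1.1, p.2)) = Ec mu (fun x => Ec mu (fun y => F (x, y))).
Proof.
move=> bF; rewrite Ec_prod //.
apply: (Ec_comp (m := fun p : X * X * X => (p.1.1, p.2))) => //.
- apply: measurable_fun_pair; first exact: measurableT_comp.
  exact: measurable_snd.
- by move=> A mA; have [] := hindep mA.
Qed.

Let law_iter (rho : probability Y R)
  (H : forall A : set Y, measurable A -> mu (xi @^-1` A) = rho A)
  (F : Y * Y -> R[i]) : bounded_mc F ->
  Ec rho (fun g => Ec rho (fun h => F (g, h))) =
  Ec mu (fun x => Ec mu (fun y => F (xi x, xi y))).
Proof.
move=> bF; rewrite -(Ec_comp mxi H); last exact: bmc_Ec1.
apply: eq_Ec => x; rewrite -(Ec_comp mxi H) //.
exact: (bmc_section1 bF).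
Qed.

(** The pairs [(x1, x2)] and [(x1, x3)] have the same law, and
    [xi(x3) = xi(x1) + xi(x2)]. *)
Let translation_invariance (b : nat -> set G) (ob : forall n, open (b n))
  (bb : forall (x : G) (V : set G), nbhs x V -> exists2 n, b n x & b n `<=` V)
  (rho : probability Y R) (H : forall A : set Y, measurable A -> mu (xi @^-1` A) = rho A)
  (F : Y * Y -> R[i]) : bounded_mc F ->
  Ec rho (fun g => Ec rho (fun h => F (g, g + h))) =
  Ec rho (fun g => Ec rho (fun h => F (g, h))).
Proof.
move=> bF; have ms := sub_borelG_measurable ob bb.
have madd : measurable_fun setT (fun p : Y * Y => p.1 + p.2).
  by apply: (mfun_add ms); [exact: measurable_fst|exact: measurable_snd].
have bF' : bounded_mc (fun p : Y * Y => F (p.1, p.1 + p.2)).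
  by apply: (bmc_comp (m := fun p : Y * Y => (p.1, p.1 + p.2))) => //; exact: measurable_fun_pair.
have mxi2 : measurable_fun setT (fun p : X * X => (xi p.1 : Y, xi p.2 : Y)).
  by apply: measurable_fun_pair; apply: (measurableT_comp mxi).
have bFx := bmc_comp mxi2 bF; have bFx' := bmc_comp mxi2 bF'.
rewrite (law_iter H bF) (law_iter H bF').
rewrite -(@Ec_lambda13 (fun p => F (xi p.1, xi p.2))) //.
rewrite -(@Ec_lambda12 (fun p => F (xi p.1, xi p.1 + xi p.2))) //.
apply: Ec_ae.
- apply: (bmc_comp (m := fun p : X * X * X => (p.1.1, p.1.2)) _ bFx').
  by apply: measurable_fun_pair; exact: measurableT_comp.
- apply: (bmc_comp (m := fun p : X * X * X => (p.1.1, p.2)) _ bFx).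
  by apply: measurable_fun_pair; [exact: measurableT_comp|exact: measurable_snd].
- by apply: filterS hsum => p /= ->.
Qed.

Lemma exists_multiplicative : exists u : X -> R[i],
  [/\ bounded_mc u, forall x, sqmod (u x) = 1, Ec mu u = 0 &
     {ae lambda, forall p, u p.2 = u p.1.1 * u p.1.2}].
Proof.
have [b [ob bb]] := countable_base cG mG.
have [rho H] := law.
have ms := sub_borelG_measurable ob bb.
have inv := translation_invariance ob bb H.
have oS (n : nat) : measurable (b n : set Y) by exact: open_borelG.
(* If every basic neighbourhood of [0] had full measure then [xi] would be [0]
   almost everywhere. *)
have [n bn0 bn1] : exists2 n, b n 0 & (rho (b n) < 1)%E.
  apply: contrapT => N; apply: hnonconst; exists 0.
  have full n : b n 0 -> mu (xi @^-1` (~` b n)) = 0%E.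
    move=> bn0; rewrite H; last exact: measurableC.
    rewrite probability_setC // (_ : rho (b n) = 1%E) ?subee //.
    apply/eqP; rewrite eq_le probability_le1 //= leNgt; apply/negP => r1.
    by apply: N; exists n.
  pose c n := if `[< b n 0 >] then xi @^-1` (~` b n) else set0.
  have : mu.-negligible (\bigcup_n c n).
    apply: negligible_bigcup => n; rewrite /c; case: asboolP => bn0; last exact: negligible_set0.
    apply/negligibleP; last exact: full.
    by apply: hxi; exact: (measurableC (oS n)).
  apply: negligibleS => x /= xn0.
  case: mG => M [f [g [fK gK cf cg]]].
  have e0 : 0 < mdist (f (xi x)) (f 0).
    rewrite mdist_gt0; apply/eqP => /(can_inj fK) E; exact: xn0.
  have : nbhs (0 : G) (f @^-1` (ball (f 0) (mdist (f (xi x)) (f 0)))).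
    by apply: cf; exact: nbhsx_ballx.
  move=> /bb [n bn0 bnV]; exists n => //; rewrite /c asboolT //= => /bnV.
  by rewrite /= ballEmdist /= metric_sym ltxx.
pose V : set Y := [set g | b n g /\ b n (- g)].
have mV : measurable V.
  apply: measurableI; first exact: oS.
  have := mfun_opp ms (@measurable_id _ Y setT) measurableT (oS n).
  by rewrite setTI.
have V1 : (rho V < 1)%E.
  by apply: le_lt_trans bn1; apply: le_measure; rewrite ?inE //; move=> x [].
have nV : nbhs (0 : G) V.
  have n0 : nbhs (0 : G) (b n) by apply: open_nbhs_nbhs.
  apply: filterI => //; apply: (@opp_continuous G 0 (b n)).
  by rewrite oppr0.
have [m Cm Cpos] : exists2 m, (forall g h : G, b m g -> b m h -> V (g - h)) & (0 < rho (b m))%E.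
  pose small (C : set G) := forall g h : G, C g -> C h -> V (g - h).
  apply: (@base_positive R G b ob rho small) => x.
  have : nbhs (x - x) V by rewrite subrr.
  have /(_ (x, x)) := @sub_continuous G; move=> /[apply] -[[A C] /= [xA xC] ACV].
  have [m bmx mA] := bb x (A `&` C) (filterI xA xC).
  exists m => // g h /mA [Ag _] /mA [_ Ch]; exact: (ACV (g, h)).
have sV g : V g -> V (- g) by case=> ? ?; split; rewrite ?opprK.
have [k [bk hk k0 k2]] := exists_kernel ms inv mV (oS m) sV Cm V1 Cpos.
have [u [bu u0 uM u1]] := character_of_kernel ms inv bk hk k0 k2.
have bux := bmc_comp mxi bu.
pose A := [set x | sqmod (u (xi x)) = 1].
have mA : measurable A.
  have [mN _] := bmf_sqmod bux.
  by have := mN measurableT _ (measurable_set1 1); rewrite setTI.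
have aeA : {ae mu, forall x, A x}.
  have mB : measurable [set g : Y | sqmod (u g) = 1].
    have [mN _] := bmf_sqmod bu.
    by have := mN measurableT _ (measurable_set1 1); rewrite setTI.
  have : rho (~` [set g : Y | sqmod (u g) = 1]) = 0%E.
    by apply/negligibleP; [exact: measurableC|exact: u1].
  rewrite -H; last exact: measurableC.
  by move=> h; apply/negligibleP => //; exact: measurableC.
(* [u] has modulus [1] almost everywhere; replacing it by [1] on the exceptional
   set makes this hold everywhere. *)
pose v x := (\1_A x)%:C%C * u (xi x) + (1 - \1_A x)%:C%C.
have vE x : A x -> v x = u (xi x).
  by move=> Ax; rewrite /v indicE mem_set // subrr mul1r addr0.
have bA : bounded_mf (\1_A : X -> R).
  exact: bmf_indic.
have bv : bounded_mc v.
  apply: bmcD; first by apply: bmcM => //; exact: bmc_real.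
  by apply: bmc_real; apply: bmfB => //; exact: bmf_cst.
exists v; split=> //.
- move=> x; have [Ax|nAx] := pselect (A x); first by rewrite vE.
  by rewrite /v indicE memNset // subr0 mul0r add0r sqmod_real expr1n.
- transitivity (Ec mu (fun x => u (xi x))).
    by apply: Ec_ae => //; apply: filterS aeA => x /vE.
  by rewrite (Ec_comp mxi H).
have m1 : measurable_fun setT (fun p : X * X * X => p.1.1) by exact: measurableT_comp.
have m2 : measurable_fun setT (fun p : X * X * X => p.1.2) by exact: measurableT_comp.
have m3 : measurable_fun setT (fun p : X * X * X => p.2) by exact: measurable_snd.
have A1 := ae_comp m1 (fun B mB => let: And3 h _ _ := hmarg mB in h) aeA.
have A2 := ae_comp m2 (fun B mB => let: And3 _ h _ := hmarg mB in h) aeA.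
have A3 := ae_comp m3 (fun B mB => let: And3 _ _ h := hmarg mB in h) aeA.
(* Multiplicativity of the character holds for almost every [h] given [g], hence
   for almost every pair by Fubini. *)
pose D (p : X * X) := u (xi p.1 + xi p.2) - u (xi p.1) * u (xi p.2).
have mp1 : measurable_fun setT (fun p : X * X => xi p.1 : Y).
  by apply: (measurableT_comp mxi).
have mp2 : measurable_fun setT (fun p : X * X => xi p.2 : Y).
  by apply: (measurableT_comp mxi).
have bD : bounded_mc D.
  apply: bmcB; first by apply: (bmc_comp (mfun_add ms mp1 mp2) bu).
  by apply: bmcM; [exact: (bmc_comp mp1 bu)|exact: (bmc_comp mp2 bu)].
have bDl : bounded_mc (fun p : X * X * X => D (p.1.1, p.1.2)).
  by apply: (bmc_comp (m := fun p : X * X * X => (p.1.1, p.1.2)) _ bD); exact: measurable_fun_pair.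
have D0 : dotc lambda (fun p : X * X * X => D (p.1.1, p.1.2)) (fun p => D (p.1.1, p.1.2)) = 0.
  rewrite /dotc (@Ec_lambda12 (fun p => D p * (D p)^*%C)); last exact: bmc_dot.
  rewrite -[RHS](Ec_cst mu); apply: eq_Ec => x.
  rewrite -[RHS](Ec_cst mu); apply: Ec_ae; [|exact: bmc_cst|].
    exact: (bmc_section1 (bmc_dot bD bD)).
  apply: filterS (ae_comp mxi H (uM (xi x))) => y E.
  by rewrite /D /= E subrr mul0r.
have Dae := dotc_eq0 bDl D0.
near=> p.
have p1 : A p.1.1 by near: p.
have p2 : A p.1.2 by near: p.
have p3 : A p.2 by near: p.
have ps : xi p.2 = xi p.1.1 + xi p.1.2 by near: p.
have pD : D (p.1.1, p.1.2) = 0 by near: p.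
rewrite !vE // ps; apply/eqP; rewrite -subr_eq0; apply/eqP; exact: pD.
Unshelve. all: by end_near.
Qed.

End Law.

(** * Saturated ideals of integer polynomials *)
Section IntegerPolynomials.
Import Pdiv.CommonRing Pdiv.RingMonic.

Lemma pigeonhole (T : finType) (f : nat -> T) : exists k l, (k < l)%N /\ f k = f l.
Proof.
pose g (i : 'I_(#|T|.+1)) := f i.
have : ~~ injectiveb g.
  apply/injectiveP => /leq_card; by rewrite card_ord ltnn.
case/injectivePn => i [j ij gij].
have [lt|ge] := ltnP i j; first by exists i, j.
exists j, i; split=> //.
by rewrite ltn_neqAle ge andbT eq_sym (inj_eq val_inj).
Qed.

Local Notation pZtoC := (map_poly (intr : int -> algC)).
Local Notation pZtoQ := (map_poly (intr : int -> rat)).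
Local Notation pQtoC := (map_poly (ratr : rat -> algC)).

Lemma pZtoC_Q (p : {poly int}) : pQtoC (pZtoQ p) = pZtoC p.
Proof.
rewrite -map_poly_comp; apply: eq_map_poly => x /=; exact: ratr_int.
Qed.

(** If [|x| >= 2] then the leading term dominates: the sum of the others is at most
    [1 + |x| + ... + |x|^(n-1) <= |x|^n - 1]. *)
Lemma root_flat_poly (p : {poly int}) (x : algC) : p != 0 ->
  (forall i, `|p`_i| <= 1) -> root (pZtoC p) x -> `|x| < 2.
Proof.
move=> p0 pc rx; rewrite real_ltNge ?normr_real ?realn //; apply/negP => x2.
have x1 : 1 < `|x| by apply: lt_le_trans x2; rewrite ltr1n.
set n := (size p).-1.
have szp : size p = n.+1 by rewrite prednK // size_poly_gt0.
have lc : 1 <= `|(lead_coef p)%:~R : algC|.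
  rewrite -intr_norm -[1](_ : 1%:~R = 1) // ler_int -gtz0_ge1 normr_gt0 lead_coef_eq0 //.
move: rx; rewrite /root horner_coef size_map_inj_poly ?rmorph0 //; last exact: intr_inj.
rewrite szp big_ord_recr /= addr_eq0 => /eqP /(congr1 Num.norm).
rewrite normrN normrM coef_map /= normrX => E.
have geom m : \sum_(i < m) `|x| ^+ i <= `|x| ^+ m - 1.
  elim: m => [|m IH]; first by rewrite big_ord0 expr0 subrr.
  rewrite big_ord_recr /= exprS; apply: le_trans (lerD IH (lexx _)) _.
  rewrite addrAC lerD2r -mulr2n -mulr_natl ler_wpM2r // exprn_ge0 //.
have U : `|\sum_(i < n) (pZtoC p)`_i * x ^+ i| <= `|x| ^+ n - 1.
  apply: le_trans (ler_norm_sum _ _ _) _; apply: le_trans (geom n).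
  apply: ler_sum => i _; rewrite normrM normrX coef_map /= -intr_norm.
  by rewrite ler_piMl ?exprn_ge0 // -[1](_ : 1%:~R = 1) // ler_int pc.
move: U; rewrite E => U.
have : `|x| ^+ n <= `|(p`_n)%:~R| * `|x| ^+ n.
  by rewrite ler_peMl ?exprn_ge0.
by move=> /le_trans /(_ U); rewrite lerDl oppr_ge0 ler10.
Qed.

Lemma powers_le1 (y : algC) : (forall k, (0 < k)%N -> `|y| ^+ k < 2) -> `|y| <= 1.
Proof.
move=> H; rewrite real_leNgt ?normr_real ?real1 //; apply/negP => y1.
have h0 : 0 < `|y| - 1 by rewrite subr_gt0.
have B k : 1 + k%:R * (`|y| - 1) <= `|y| ^+ k.
  elim: k => [|k IH]; first by rewrite mul0r addr0 expr0.
  rewrite exprS; apply: le_trans (ler_wpM2l (normr_ge0 y) IH).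
  rewrite -subr_ge0 (_ : _ - _ = k%:R * (`|y| - 1) ^+ 2).
    by rewrite mulr_ge0 ?exprn_ge0 // ltW.
  by rewrite -natr1; ring.
have [k Hk] : exists k : nat, 1 / (`|y| - 1) < k%:R.
  have r : 0 <= 1 / (`|y| - 1) by rewrite divr_ge0 // ltW.
  by exists (Num.bound (1 / (`|y| - 1))); exact: archi_boundP.
have := H k.+1 isT; rewrite real_ltNge ?realn ?realX ?normr_real // => /negP; apply.
apply: le_trans (B _).
rewrite -[2](_ : 1 + 1 = 2) // lerD2l -ler_pdivrMr //.
by apply: (le_trans (ltW Hk)); rewrite ler_nat.
Qed.

Section FiniteRemainders.

(** The remainder of [X^n] takes the values [b^n] at the roots [b] of [m].  These are
    bounded, and the coefficients depend linearly on them, through the inverse of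
    a Vandermonde matrix. *)
Lemma bounded_remainders (m : {poly int}) : m \is monic ->
  (forall x, root (pZtoC m) x -> `|x| <= 1) ->
  separable.separable_poly (pZtoC m) ->
  exists N : nat, forall n i, `|(rmodp 'X^n m)`_i| <= N%:Z.
Proof.
move=> mm rle sep.
have mC : pZtoC m \is monic by exact: monic_map.
have [bs Dbs] := closed_field_poly_normal (pZtoC m).
rewrite (monicP mC) scale1r in Dbs.
have ubs : uniq bs by rewrite -separable.separable_prod_XsubC -Dbs.
set d := size bs.
have szm : size m = d.+1.
  by rewrite -(size_map_inj_poly (intr_inj (R := algC))) ?rmorph0 // Dbs size_prod_XsubC.
pose a : 'rV[algC]_d := \row_j bs`_j.
pose V := Vandermonde d a.
have uV : V \in unitmx.
  rewrite unitmxE det_Vandermonde unitfE; apply/prodf_neq0 => i _; apply/prodf_neq0 => j ij.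
  by rewrite !mxE subr_eq0 nth_uniq // ?ltn_ord // gtn_eqF.
pose c n : 'rV[algC]_d := \row_i ((rmodp 'X^n m)`_i)%:~R.
have szr n : (size (rmodp 'X^n m) <= d)%N.
  by have := ltn_rmodpN0 'X^n (monic_neq0 mm); rewrite szm ltnS.
have root_bs j : (j < d)%N -> root (pZtoC m) bs`_j.
  by move=> jd; rewrite Dbs root_prod_XsubC mem_nth.
have cV n : c n *m V = \row_j bs`_j ^+ n.
  apply/rowP => j; rewrite !mxE.
  have := rdivp_eq mm 'X^n => /(congr1 (fun p => (pZtoC p).[bs`_j])).
  rewrite rmorphD rmorphM /= hornerD hornerM (rootP (root_bs j (ltn_ord j))) mulr0 add0r.
  rewrite map_polyXn hornerXn => ->.
  rewrite (horner_coef_wide _ (n := d)); last first.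
    by rewrite size_map_inj_poly ?rmorph0 //; exact: intr_inj.
  by apply: eq_bigr => i _; rewrite !mxE coef_map.
pose W := invmx V.
have cE n : c n = (\row_j bs`_j ^+ n) *m W by rewrite -cV mulmxK.
pose B := \sum_i \sum_j `|W i j|.
have B0 : 0 <= B by apply: sumr_ge0 => i _; apply: sumr_ge0.
have cB n i : `|c n 0 i| <= B.
  rewrite cE mxE; apply: le_trans (ler_norm_sum _ _ _) _.
  apply: ler_sum => j _; rewrite mxE normrM normrX.
  apply: (@le_trans _ _ `|W j i|).
    by rewrite ler_piMl // exprn_ile1 // rle // root_bs.
  by rewrite (bigD1 i) //= lerDl sumr_ge0.
exists (Num.bound B) => n i.
have [id|di] := ltnP i d; last by rewrite nth_default ?normr0 // (leq_trans (szr n)).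
have := cB n (Ordinal id); rewrite mxE /= -intr_norm => H.
rewrite -(ler_int algC); apply: le_trans H _.
by rewrite -pmulrn; apply/ltW/archi_boundP.
Qed.

Lemma bounded_powers_eq (m : {poly int}) (N : nat) :
  (forall n i, `|(rmodp 'X^n m)`_i| <= N%:Z) -> m \is monic ->
  exists k l, (k < l)%N /\ exists s, 'X^l - 'X^k = s * m.
Proof.
move=> H mm; set d := size m.
pose f n := [ffun i : 'I_d => inord (absz ((rmodp 'X^n m)`_i + N%:Z)) : 'I_(2 * N).+1].
have [k [l [kl fkl]]] := pigeonhole f.
exists k, l; split=> //; exists (rdivp 'X^l m - rdivp 'X^k m).
rewrite [in LHS](rdivp_eq mm 'X^l) [in LHS](rdivp_eq mm 'X^k) mulrBl.
suff -> : rmodp 'X^l m = rmodp 'X^k m by ring.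
apply/polyP => i; have [id|di] := ltnP i d; last first.
  rewrite !nth_default // (leq_trans _ di) // ltnW // ltn_rmodpN0 // monic_neq0 //.
have /ffunP/(_ (Ordinal id)) := fkl; rewrite !ffunE => /(congr1 val) /=.
have := H l i; have := H k i; move: (_`_i) (_`_i) => x y hx hy.
by rewrite !inordK; lia.
Qed.

Lemma modulo_powers_eq (m : {poly int}) (c : nat) : m \is monic -> (0 < c)%N ->
  exists k l, (k < l)%N /\ exists s t, 'X^l - 'X^k = s * m + t * (c%:Z)%:P.
Proof.
move=> mm c0; set d := size m.
pose f n := [ffun i : 'I_d => inord (absz (modz (rmodp 'X^n m)`_i c%:Z)) : 'I_c.-1.+1].
have [k [l [kl fkl]]] := pigeonhole f.
exists k, l; split=> //; exists (rdivp 'X^l m - rdivp 'X^k m).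
pose D := rmodp 'X^l m - rmodp 'X^k m.
exists (\poly_(i < d) (D`_i %/ c%:Z)%Z).
rewrite [in LHS](rdivp_eq mm 'X^l) [in LHS](rdivp_eq mm 'X^k) mulrBl.
suff : D = \poly_(i < d) (D`_i %/ c%:Z)%Z * (c%:Z)%:P by rewrite /D => <-; ring.
apply/polyP => i; rewrite coefMC coef_poly; have [id|di] := ltnP i d; last first.
  rewrite mul0r /D coefB !nth_default ?subrr // (leq_trans _ di) // ltnW //.
    by rewrite ltn_rmodpN0 // monic_neq0.
  by rewrite ltn_rmodpN0 // monic_neq0.
have /ffunP/(_ (Ordinal id)) := fkl; rewrite !ffunE => /(congr1 val) /=.
rewrite coefB; move: ((rmodp 'X^l m)`_i) ((rmodp 'X^k m)`_i) => x y.
have cz : (c%:Z != 0) by lia.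
have hx := modz_ge0 x cz; have hy := modz_ge0 y cz.
have hx' := ltz_mod x cz; have hy' := ltz_mod y cz.
rewrite !inordK; try lia.
move=> E; have {}E : (x = y %[mod c%:Z])%Z by lia.
by apply/esym/divzK; rewrite -eqz_mod_dvd; apply/eqP.
Qed.

End FiniteRemainders.

Lemma norm1_sqr (x : int) : `|x| = 1 -> x * x = 1.
Proof. by move=> h; have [->|->] : x = 1 \/ x = - 1 by lia. Qed.

Section SaturatedIdeal.
Variable I : {poly int} -> Prop.
Hypotheses (ID : forall p q, I p -> I q -> I (p + q))
  (IM : forall p q, I p -> I (q * p))
  (Isat : forall k l q, (k < l)%N -> I (('X^l - 'X^k) * q) -> I q)
  (Iflat : forall k, (0 < k)%N -> exists p : {poly int}, [/\ p != 0, forall i, `|p`_i| <= 1 &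
     I (p \Po 'X^k)]).

Let flat1 : exists p : {poly int}, [/\ p != 0, `|lead_coef p| = 1 & I p].
Proof.
have [p [p0 pc]] := Iflat (ltn0Sn 0); rewrite comp_polyXr => Ip.
exists p; split=> //; apply/eqP; rewrite eq_le pc /= -gtz0_ge1 normr_gt0.
by rewrite lead_coef_eq0.
Qed.

(** [I] contains a monic [m] and a constant [c].  There are finitely many remainders
    modulo [m] and [c], so some [X^l - X^k] is in [I], and it can be cancelled. *)
Lemma saturated_const (c : int) : c != 0 -> I c%:P -> I 1.
Proof.
move=> c0 Ic; have [p [p0 lp Ip]] := flat1.
have [m mm Im] : exists2 m, m \is monic & I m.
  exists ((lead_coef p)%:P * p); last exact: IM.
  rewrite monicE lead_coefM lead_coefC.
  by apply/eqP/norm1_sqr.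
have c0' : (0 < absz c)%N by rewrite absz_gt0.
have [k [l [kl [s [t E]]]]] := modulo_powers_eq mm c0'.
apply: (Isat kl); rewrite mulr1 E; apply: ID; first exact: IM.
apply: IM; rewrite (_ : (absz c)%:Z = sgz c * c) ?polyCM; first exact: IM.
by rewrite abszE; lia.
Qed.

(** Let [q] be an element of minimal degree, and suppose that it has a root [x].
    The primitive minimal polynomial [r] of [x] divides every element of [I];
    its leading coefficient divides that of a flat polynomial, so it is [1] or
    [-1].  All the roots of [r] are in the closed unit disc, so [r] divides some
    [X^l - X^k].  Then [(X^l - X^k) (q / r)] is in [I], and so is [q / r],
    contradicting minimality. *)
Lemma saturated_ideal_full : I 1.
Proof.
have [p1 [p10 lp1 Ip1]] := flat1.
have exI : exists n, `[< exists q, [/\ q != 0, I q & size q = n] >].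
  by exists (size p1); apply/asboolP; exists p1.
case: (ex_minnP exI) => n /asboolP [q [q0 Iq szq]] nmin.
have qmin r : I r -> r != 0 -> (size q <= size r)%N.
  by move=> Ir r0; rewrite szq; apply: nmin; apply/asboolP; exists r.
have [sz1|sz1] := eqVneq (size q) 1%N.
  have /eqP/size_poly1P [c c0 qc] := sz1; apply: (saturated_const c0).
  by rewrite -qc.
(* By minimality of its degree, [q] divides every element of [I] over the rationals. *)
have Iroot p x : I p -> root (pZtoC q) x -> root (pZtoC p) x.
  move=> Ip rx; have E := Pdiv.Idomain.divp_eq p q.
  have r0 : p %% q = 0.
    apply/eqP/contraT => r0.
    have := qmin (p %% q); rewrite leqNgt ltn_modp q0 => /(_ _ r0) H; apply: H.
    have -> : p %% q = (lead_coef q ^+ scalp p q)%:P * p + (- (p %/ q)) * q.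
      by rewrite mul_polyC E; ring.
    by apply: ID; apply: IM.
  move/(congr1 (fun p => (pZtoC p).[x])): E; rewrite r0 addr0 rmorphM hornerM (rootP rx) mulr0.
  rewrite map_polyZ hornerZ => /eqP; rewrite mulf_eq0 => /orP[/eqP|/eqP /rootP //].
  move/eqP; rewrite /= rmorphXn expf_eq0 intr_eq0 lead_coef_eq0 (negPf q0) andbF //.
have [x rx] : exists x, root (pZtoC q) x.
  apply/closed_rootP; by rewrite size_map_inj_poly ?rmorph0 //; exact: intr_inj.
have [rQ [minx mQ rootQ]] := minCpolyP x.
have [rZ [a a0 rQE]] := rat_poly_scale rQ.
have divZ p : root (pZtoC p) x -> exists t, p = zprimitive rZ * t.
  rewrite -pZtoC_Q rootQ rQE => h.
  have {}h : pZtoQ rZ %| pZtoQ p.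
    by move: h; rewrite dvdpZl // invr_neq0 // intr_eq0.
  by rewrite dvdp_rat_int in h; have [t ->] := dvdpP_int h; exists t.
have [q1 qE] := divZ q rx.
have [p2 p1E] := divZ p1 (Iroot _ _ Ip1 rx).
set r := zprimitive rZ in qE p1E.
have lr : `|lead_coef r| = 1.
  have := lp1; rewrite p1E lead_coefM; move: (lead_coef r) (lead_coef p2) => u v uv.
  have : (absz u * absz v == 1)%N by rewrite -abszM; lia.
  by rewrite muln_eq1 => /andP[/eqP h _]; lia.
pose m := (lead_coef r)%:P * r.
have ll : lead_coef r * lead_coef r = 1.
  exact: norm1_sqr.
have rE : r = (lead_coef r)%:P * m by rewrite /m mulrA -polyCM ll mul1r.
have mm : m \is monic by rewrite monicE lead_coefM lead_coefC ll.
have m_r y : root (pZtoC m) y -> root (pZtoC r) y.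
  by move=> ry; rewrite rE rmorphM rootM ry orbT.
have rle y : root (pZtoC m) y -> `|y| <= 1.
  move=> /m_r ry; apply: powers_le1 => k k0; rewrite -normrX.
  have [p [p0 pc Ip]] := Iflat k0; apply: (root_flat_poly p0 pc).
  have : root (pZtoC (p \Po 'X^k)) y.
    by apply: Iroot => //; rewrite qE rmorphM rootM ry.
  by rewrite map_comp_poly map_polyXn /root horner_comp hornerXn.
(* Over the rationals [m] is a multiple of the minimal polynomial of [x], hence
   separable. *)
have rE' : exists2 b : rat, b != 0 & pZtoQ m = b *: rQ.
  have Dr : pZtoQ rZ = a%:~R *: rQ by rewrite rQE scalerA divff ?scale1r // intr_eq0.
  have zc : zcontents rZ != 0.
    rewrite zcontents_eq0; apply: contra_neq q0 => r0; by rewrite qE /r r0 zprimitive0 mul0r.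
  exists ((lead_coef r)%:~R * (zcontents rZ)%:~R^-1 * a%:~R).
    rewrite !mulf_neq0 ?invr_neq0 ?intr_eq0 // lead_coef_eq0.
    by apply: contra_neq q0 => r0; rewrite qE r0 mul0r.
  have Dz : pZtoQ rZ = (zcontents rZ)%:~R *: pZtoQ r.
    by rewrite {1}(zpolyEprim rZ) map_polyZ.
  rewrite -!scalerA -Dr Dz [_^-1 *: _]scalerA mulVf ?intr_eq0 // scale1r.
  by rewrite /m rmorphM /= map_polyC /= mul_polyC.
have sep : separable.separable_poly (pZtoC m).
  have [b b0 mb] := rE'.
  rewrite -pZtoC_Q mb separable.separable_map.
  rewrite unlock derivZ coprimepZl // coprimepZr //.
  rewrite -(coprimep_map (ratr : {rmorphism rat -> algC})) coprimep_def.
  apply/negPn/negP => /closed_rootP [y].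
  rewrite root_gcd -deriv_map => /andP[ry ry'].
  have [sQ [miny msQ rootS]] := minCpolyP y.
  move: ry; rewrite rootS => /dvdpP [h rQh].
  have szs : (1 < size sQ)%N.
    by have := size_minCpoly y; rewrite miny size_map_inj_poly ?rmorph0 //; exact: fmorph_inj.
  have rQ0 : rQ != 0 by exact: monic_neq0.
  have sQ0 : sQ != 0 by exact: monic_neq0.
  have h0 : h != 0 by apply: contra_neq rQ0 => h0; rewrite rQh h0 mul0r.
  have szr : size rQ = (size h + size sQ).-1 by rewrite rQh size_mul.
  have hpos : (0 < size h)%N by rewrite size_poly_gt0.
  have : root (pQtoC rQ) x by rewrite rootQ.
  rewrite rQh rmorphM rootM !rootQ => /orP[dh|ds].
    have := dvdp_leq h0 dh; rewrite szr; move: szs hpos.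
    by move: (size h) (size sQ) => u v; clear; lia.
  have szr2 : (1 < size rQ)%N.
    by rewrite szr; move: szs hpos; move: (size h) (size sQ) => u v; clear; lia.
  move: ry'; rewrite deriv_map rootS => ds'.
  have d0 : rQ^`() != 0.
    apply/eqP => /(congr1 (fun p : {poly rat} => p`_(size rQ).-2)).
    rewrite coef_deriv coef0 => /eqP; rewrite mulrn_eq0 /= prednK; last first.
      by rewrite -ltnS prednK // ltnW.
    by rewrite -/(lead_coef rQ) lead_coef_eq0 (negPf rQ0).
  have := dvdp_leq d0 (dvdp_trans ds ds').
  by rewrite leqNgt lt_size_deriv.
have [N HN] := bounded_remainders mm rle sep.
have [k [l [kl [s E]]]] := bounded_powers_eq HN mm.
have Iq1 : I q1.
  apply: (Isat kl); rewrite E (_ : _ * q1 = (s * (lead_coef r)%:P) * q); first exact: IM.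
  by rewrite qE /m; ring.
have q10 : q1 != 0 by apply: contra_neq q0 => q10; rewrite qE q10 mulr0.
have r0 : r != 0 by apply: contra_neq q0 => r0; rewrite qE r0 mul0r.
have szr2 : (1 < size r)%N.
  have [b b0 mb] := rE'.
  have szx : (1 < size rQ)%N.
    by have := size_minCpoly x; rewrite minx size_map_inj_poly ?rmorph0 //; exact: fmorph_inj.
  have : size m = size rQ.
    by rewrite -(size_map_inj_poly (intr_inj (R := rat))) ?rmorph0 // mb size_scale.
  by rewrite /m mul_polyC size_scale ?lead_coef_eq0 // => ->.
have := qmin _ Iq1 q10; rewrite qE size_mul //.
have : (0 < size q1)%N by rewrite size_poly_gt0.
by move: szr2; move: (size r) (size q1) => u v; clear; lia.
Qed.

End SaturatedIdeal.

End IntegerPolynomials.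

(** * Subadditivity and entropy *)
Lemma fekete (R : realType) (a : nat -> R) : (forall n, 0 <= a n) ->
  (forall m n, a (m + n)%N <= a m + a n) ->
  exists L : R, (fun n => a n / n%:R) @ \oo --> L.
Proof.
move=> a0 sub.
pose S := [set x : R | exists2 n, (0 < n)%N & x = a n / n%:R].
have hS : has_inf S.
  split; first by exists (a 1%N / 1%:R), 1%N.
  by exists 0 => _ [n _ ->]; rewrite divr_ge0.
exists (inf S); apply/cvgrPdist_le => e e0.
have e20 : 0 < e / 2 by rewrite divr_gt0.
(* Compare [a n] with [(n %/ m) a m], for a fixed [m] whose ratio is nearly minimal. *)
have [_ [m m0 ->] am] := inf_adherent e20 hS.
have mR : 0 < m%:R :> R by rewrite ltr0n.
have amul q r : a (q * m + r)%N <= q%:R * a m + a r.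
  elim: q => [|q IH]; first by rewrite mul0n add0n mul0r add0r.
  rewrite mulSn -addnA; apply: le_trans (sub _ _) _.
  by rewrite -natr1 mulrDl mul1r; move: IH; lra.
pose C := \sum_(r < m) a r.
have aC r : (r < m)%N -> a r <= C.
  by move=> rm; rewrite /C (bigD1 (Ordinal rm)) //= lerDl sumr_ge0.
have C0 : 0 <= C by rewrite sumr_ge0.
exists (Num.bound (C / (e / 2))).+1 => // n /= Nn.
have n0 : (0 < n)%N by apply: leq_trans Nn.
have nR : 0 < n%:R :> R by rewrite ltr0n.
have infn : inf S <= a n / n%:R by apply: ge_inf; [case: hS|exists n].
rewrite distrC ger0_norm ?subr_ge0 // lerBlDr.
have Cn : C / n%:R <= e / 2.
  rewrite ler_pdivrMr // -ler_pdivrMl // mulrC.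
  apply: ltW; apply: (@lt_le_trans _ _ (Num.bound (C / (e / 2)))%:R).
    by apply: archi_boundP; rewrite divr_ge0 // ltW.
  by rewrite ler_nat ltnW.
have : a n / n%:R <= a m / m%:R + C / n%:R.
  have := amul (n %/ m)%N (n %% m)%N; rewrite -divn_eq => h.
  have hr := aC _ (ltn_pmod n m0).
  rewrite -lerBlDr -mulrBl ler_pdivrMr //.
  apply: (@le_trans _ _ ((n %/ m)%:R * a m)); first by move: h hr; lra.
  rewrite mulrC -mulrA ler_wpM2l // ler_pdivlMl //.
  by rewrite -natrM ler_nat mulnC leq_trunc_div.
by move: am Cn; lra.
Qed.

Lemma ln_le_sub1 (R : realType) (x : R) : 0 < x -> ln x <= x - 1.
Proof.
move=> x0; have := expR_ge1Dx (ln x); rewrite lnK ?posrE //; lra.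
Qed.

(** [p] is a law on words, [a] and [b] are its images under the two maps [s1] and [s2]
    that jointly determine the word.  The inequality is that of Gibbs between [p]
    and the product of [a] and [b], summed from [ln t <= t - 1]. *)
Lemma entropy_subadditive (R : realType) (W A B : finType) (s1 : W -> A) (s2 : W -> B)
  (p : W -> R) (a : A -> R) (b : B -> R) :
  (forall w w', s1 w = s1 w' -> s2 w = s2 w' -> w = w') ->
  (forall w, 0 <= p w) -> \sum_w p w = 1 ->
  (forall x, a x = \sum_(w | s1 w == x) p w) ->
  (forall y, b y = \sum_(w | s2 w == y) p w) ->
  - \sum_w p w * ln (p w) <=
    (- \sum_x a x * ln (a x)) + (- \sum_y b y * ln (b y)).
Proof.
move=> sinj p0 p1 aE bE.
have a0 x : 0 <= a x by rewrite aE sumr_ge0.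
have b0 y : 0 <= b y by rewrite bE sumr_ge0.
have ap w : p w <= a (s1 w) by rewrite aE (bigD1 w) //= lerDl sumr_ge0.
have bp w : p w <= b (s2 w) by rewrite bE (bigD1 w) //= lerDl sumr_ge0.
have suma : \sum_x a x = 1.
  by (under eq_bigr do rewrite aE); rewrite -[RHS]p1 [RHS](partition_big s1 xpredT).
have sumb : \sum_y b y = 1.
  by (under eq_bigr do rewrite bE); rewrite -[RHS]p1 [RHS](partition_big s2 xpredT).
have -> : \sum_x a x * ln (a x) = \sum_w p w * ln (a (s1 w)).
  rewrite (partition_big s1 xpredT) //=; apply: eq_bigr => x _.
  by rewrite [X in X * _]aE mulr_suml; apply: eq_bigr => w /eqP ->.
have -> : \sum_y b y * ln (b y) = \sum_w p w * ln (b (s2 w)).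
  rewrite (partition_big s2 xpredT) //=; apply: eq_bigr => x _.
  by rewrite [X in X * _]bE mulr_suml; apply: eq_bigr => w /eqP ->.
have key w : p w * ln (a (s1 w)) + p w * ln (b (s2 w)) - p w * ln (p w) <=
    a (s1 w) * b (s2 w) - p w.
  have [pw0|pwn0] := eqVneq (p w) 0.
    by rewrite pw0 !mul0r addr0 subr0 subr0 mulr_ge0.
  have pw : 0 < p w by rewrite lt_def pwn0 p0.
  have apos : 0 < a (s1 w) by exact: lt_le_trans pw (ap w).
  have bpos : 0 < b (s2 w) by exact: lt_le_trans pw (bp w).
  have := @ln_le_sub1 _ (a (s1 w) * b (s2 w) / p w) ltac:(by rewrite !mulr_gt0 // invr_gt0).
  rewrite ln_div ?posrE ?mulr_gt0 // lnM ?posrE // => h.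
  have := ler_wpM2l (ltW pw) h.
  rewrite [X in _ <= X]mulrBr mulr1 [p w * (_ / _)]mulrC divfK //.
  by rewrite !mulrBr !mulrDr.
have sumab : \sum_w a (s1 w) * b (s2 w) <= 1.
  have -> : 1 = \sum_(z : A * B) a z.1 * b z.2.
    rewrite -(pair_bigA _ (fun x y => a x * b y)) /=.
    by under eq_bigr do rewrite -mulr_sumr sumb mulr1.
  rewrite (partition_big (fun w => (s1 w, s2 w)) xpredT) //=.
  apply: ler_sum => -[x y] _ /=.
  have [w0 /eqP [e1 e2]|none] := pickP (fun w => (s1 w, s2 w) == (x, y)).
    rewrite (big_pred1 w0) ?e1 ?e2 // => w /=; apply/eqP/eqP => [[h1 h2]|->]; last by rewrite e1 e2.
    by apply: sinj; rewrite ?h1 ?h2.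
  by rewrite big_pred0 // mulr_ge0.
have : \sum_w (p w * ln (a (s1 w)) + p w * ln (b (s2 w)) - p w * ln (p w)) <=
   \sum_w (a (s1 w) * b (s2 w) - p w) by apply: ler_sum => w _; exact: key.
rewrite !sumrB big_split /= p1; move: sumab; lra.
Qed.

(** * Functions of modulus one *)
Section UnitModulus.
Context (R : realType).
Implicit Types z : R[i].

Lemma sqmod_1_neq0 z : sqmod z = 1 -> z != 0.
Proof.
move=> z1; apply/eqP => z0; move: z1; rewrite z0 /sqmod /= !expr0n addr0 => /eqP.
by rewrite eq_sym oner_eq0.
Qed.

Lemma sqmod_1_inv z : sqmod z = 1 -> z^-1 = z^*%C.
Proof.
move=> z1; apply: (mulfI (sqmod_1_neq0 z1)).
by rewrite mulfV ?sqmod_1_neq0 // -sqmodE z1.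
Qed.

Lemma sqmod_exprz z (n : int) : sqmod z = 1 -> sqmod (z ^ n) = 1.
Proof.
move=> z1; have H m : sqmod (z ^+ m) = 1.
  elim: m => [|m IH]; first by rewrite expr0 sqmod_real expr1n.
  by rewrite exprS sqmodM z1 IH mulr1.
case: n => n; first by rewrite -exprnP.
by rewrite NegzE -exprnN sqmod_1_inv // sqmod_conj.
Qed.

Lemma bmc_exprz d (X : measurableType d) (f : X -> R[i]) (n : int) :
  bounded_mc f -> (forall x, sqmod (f x) = 1) -> bounded_mc (fun x => f x ^ n).
Proof.
move=> bf f1; have H (g : X -> R[i]) m : bounded_mc g -> bounded_mc (fun x => g x ^+ m).
  move=> bg; elim: m => [|m IH]; first by (under eq_fun do rewrite expr0); exact: bmc_cst.
  by (under eq_fun do rewrite exprS); exact: bmcM.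
case: n => n; first exact: H.
under eq_fun => x do rewrite NegzE -exprnN -exprVn sqmod_1_inv //.
by apply: H; exact: bmc_conj.
Qed.

End UnitModulus.

(** * Multiplicative functions and their annihilator *)
Section Dynamics.
Context (R : realType) d (X : measurableType d).
Variables (mu : probability X R) (T : X -> X) (lambda : probability (X * X * X)%type R).
Hypotheses (mT : measurable_fun setT T) (pT : measure_preserving mu T)
  (herg : ergodic mu T) (hjoin : self_joining3 mu T lambda)
  (hindep : pairwise_independent_marginals mu lambda).

Let mu_T (A : set X) : measurable A -> mu (T @^-1` A) = mu A.
Proof. exact: pT. Qed.

Lemma mfun_iter n : measurable_fun setT (iter n T).
Proof.
elim: n => [|n IH]; first exact: measurable_id.
by rewrite (_ : iter n.+1 T = T \o iter n T) //; exact: measurableT_comp.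
Qed.

Lemma mu_iter n (A : set X) : measurable A -> mu (iter n T @^-1` A) = mu A.
Proof.
elim: n A => [//|n IH] A mA.
rewrite (_ : iter n.+1 T @^-1` A = iter n T @^-1` (T @^-1` A)) //.
rewrite IH ?mu_T //; by rewrite -[X in measurable X]setTI; exact: mT.
Qed.

Lemma Ec_iter n (f : X -> R[i]) : bounded_mc f -> Ec mu (fun x => f (iter n T x)) = Ec mu f.
Proof. by move=> bf; apply: Ec_comp => //; [exact: mfun_iter|move=> A; exact: mu_iter]. Qed.

Lemma ae_iter n (A : X -> Prop) : {ae mu, forall x, A x} -> {ae mu, forall x, A (iter n T x)}.
Proof. by apply: ae_comp; [exact: mfun_iter|move=> B; exact: mu_iter]. Qed.

(** Ergodicity speaks of strictly invariant sets, whereas the set where [0 < f] is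
    only invariant up to a null set.  The set of the points that visit it
    infinitely often is strictly invariant and differs from it by a null set.
    So [f] has a constant sign almost everywhere, and the mean of [|f|] is zero. *)
Lemma ergodic_mean0 (f : X -> R) : bounded_mf f ->
  {ae mu, forall x, f (T x) = f x} -> Er mu f = 0 -> {ae mu, forall x, f x = 0}.
Proof.
move=> bf fT f0; have [mf _] := bf.
have aeT : {ae mu, forall x, forall n, f (iter n T x) = f x}.
  have H n : {ae mu, forall x, f (T (iter n T x)) = f (iter n T x)}.
    exact: (ae_iter n fT).
  have := negligible_bigcup H; apply: negligibleS => x /= nx.
  apply: contrapT => N; apply: nx => n; elim: n => [//|n IH] /=.
  by rewrite -IH; apply: contrapT => M; apply: N; exists n.
pose B := \bigcap_N \bigcup_(n in [set n | (N <= n)%N]) (iter n T @^-1` [set x | 0 < f x]).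
have mpos : measurable [set x | 0 < f x].
  rewrite (_ : [set x | _] = setT `&` f @^-1` `]0, +oo[%classic).
    by apply: mf => //; exact: measurable_itv.
  by rewrite setTI; apply/seteqP; split=> x /=; rewrite in_itv /= andbT.
have mB : measurable B.
  apply: bigcap_measurable => // N _; apply: bigcup_measurable => n _.
  by have := mfun_iter n measurableT mpos; rewrite setTI.
have BT : T @^-1` B = B.
  apply/seteqP; split=> x Bx N _.
    have [n Nn] := Bx N I; rewrite /= -iterSr => h.
    by exists n.+1; [exact: leqW|exact: h].
  have [[//|n] Nn h] := Bx N.+1 I; exists n => //=.
  by rewrite -iterSr; exact: h.
have normE (s : R) : {ae mu, forall x, `|f x| = s * f x} -> {ae mu, forall x, f x = 0}.
  move=> fs.
  have bn : bounded_mf (fun x => `|f x|).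
    split; first exact: measurableT_comp.
    by have [_ [M fM]] := bf; exists M => x; rewrite normr_id.
  have bsf : bounded_mf (fun x => s * f x) by apply: bmfM => //; exact: bmf_cst.
  have E0 : Er mu (fun x => `|f x|) = 0.
    rewrite (@Er_ae _ _ _ mu _ (fun x => s * f x)) //; [|by case: bn|by case: bsf].
    by rewrite ErZ // f0 mulr0.
  apply: filterS (Er_eq0_ae bn (fun x => normr_ge0 _) E0) => x /eqP.
  by rewrite normr_eq0 => /eqP.
have nB : mu B = 0%E -> {ae mu, forall x, ~ B x}.
  by move=> h; apply/negligibleP => //; rewrite (_ : ~` _ = B) // setCK.
case: (herg mB BT) => hB.
  apply: (normE (-1)); near=> x.
  have nBx : ~ B x by near: x; exact: nB.
  have fx : forall n, f (iter n T x) = f x by near: x.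
  rewrite mulN1r ler0_norm // leNgt; apply/negP => fpos; apply: nBx => N _.
  by exists N; rewrite /= ?leqnn // fx.
have hC : {ae mu, forall x, B x}.
  have h := probability_setC mu mB; rewrite hB subee // in h.
  by apply/negligibleP; [exact: measurableC|exact: h].
apply: (normE 1); near=> x.
have Bx : B x by near: x.
have fx : forall n, f (iter n T x) = f x by near: x.
have [n _ /=] := Bx 0%N I; rewrite fx => fpos.
by rewrite mul1r gtr0_norm.
Unshelve. all: by end_near.
Qed.

(** With the translation structure replaced by the joining, these play the role of
    the characters of a group. *)
Definition multiplicative_fun (f : X -> R[i]) := [/\ bounded_mc f,
  forall x, sqmod (f x) = 1 &
  {ae lambda, forall p : X * X * X, f p.2 = f p.1.1 * f p.1.2}].

Lemma multf_cst1 : multiplicative_fun (fun=> 1).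
Proof.
split; [exact: bmc_cst|by move=> x; rewrite sqmod_real expr1n|].
by apply: aeW => p; rewrite mulr1.
Qed.

Lemma multfM f g : multiplicative_fun f -> multiplicative_fun g ->
  multiplicative_fun (fun x => f x * g x).
Proof.
move=> [bf f1 fm] [bg g1 gm]; split; first exact: bmcM.
  by move=> x; rewrite sqmodM f1 g1 mulr1.
by apply: filterS2 fm gm => p -> ->; rewrite mulrACA.
Qed.

Lemma multfX f (n : int) : multiplicative_fun f -> multiplicative_fun (fun x => f x ^ n).
Proof.
move=> [bf f1 fm]; split; first exact: bmc_exprz.
  by move=> x; exact: sqmod_exprz.
by apply: filterS fm => p ->; rewrite expfzMl.
Qed.

Lemma multfT f : multiplicative_fun f -> multiplicative_fun (fun x => f (T x)).
Proof.
move=> [bf f1 fm]; split; first exact: (bmc_comp mT bf).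
  by move=> x.
have mT3 : measurable_fun setT (fun p : X * X * X => ((T p.1.1, T p.1.2), T p.2)).
  apply: measurable_fun_pair; first apply: measurable_fun_pair.
  - by apply: (measurableT_comp mT); exact: measurableT_comp.
  - by apply: (measurableT_comp mT); exact: measurableT_comp.
  - by apply: (measurableT_comp mT); exact: measurable_snd.
exact: (ae_comp mT3 hjoin.1 fm).
Qed.

Lemma multf_iter f n : multiplicative_fun f -> multiplicative_fun (fun x => f (iter n T x)).
Proof.
move=> mf; elim: n => [//|n IH].
rewrite (_ : (fun x => _) = (fun x => f (iter n T (T x)))); first exact: (multfT IH).
by apply/funext => x; rewrite -iterSr.
Qed.

Lemma multf_prod (J : Type) (r : seq J) (F : J -> X -> R[i]) :
  (forall j, multiplicative_fun (F j)) -> multiplicative_fun (fun x => \prod_(j <- r) F j x).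
Proof.
move=> mF; elim: r => [|j r IH].
  by (under eq_fun do rewrite big_nil); exact: multf_cst1.
by (under eq_fun do rewrite big_cons); exact: multfM.
Qed.

(** The mean is idempotent, by independence of the first two coordinates.  If it is
    [1], then [f] attains the Cauchy-Schwarz bound against the constant [1]. *)
Lemma multf_dichotomy f : multiplicative_fun f ->
  Ec mu f = 0 \/ Ec mu f = 1 /\ {ae mu, forall x, f x = 1}.
Proof.
move=> [bf f1 fm].
have b12 : bounded_mc (fun p : X * X => f p.1 * f p.2).
  by apply: bmcM; apply: (bmc_comp _ bf).
have E : Ec mu f = Ec mu f * Ec mu f.
  have h3 (A : set X) : measurable A -> lambda ((fun p : X * X * X => p.2) @^-1` A) = mu A.
    by move=> mA; have [_ _] := hjoin.2 A mA.
  rewrite -[LHS](Ec_comp (measurable_snd : measurable_fun setT (fun p : X * X * X => p.2)) h3 bf).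
  transitivity (Ec lambda (fun p => f p.1.1 * f p.1.2)).
    apply: Ec_ae => //.
      by apply: (bmc_comp _ bf); exact: measurable_snd.
    by apply: bmcM; apply: (bmc_comp _ bf); exact: measurableT_comp.
  rewrite (@Ec_lambda12 _ _ _ mu lambda hindep (fun p => f p.1 * f p.2)) //.
  rewrite -EcZ //; under [RHS]eq_Ec do rewrite mulrC -EcZ //.
  by [].
have [->|n0] := eqVneq (Ec mu f) 0; [by left|right].
have E1 : Ec mu f = 1 by apply: (mulfI n0); rewrite -E mulr1.
split=> //.
have bf1 : bounded_mc (fun x => f x - 1) by apply: bmcB => //; exact: bmc_cst.
have n1 : nrm2 mu f = 1.
  by rewrite /nrm2 -[RHS](Er_cst mu); apply: eq_Er => x; rewrite f1.
have : nrm2 mu (fun x => f x - 1) = 0.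
  rewrite nrm2B //; last exact: bmc_cst.
  rewrite n1 (_ : dotc mu f (fun=> 1) = 1); last first.
    by rewrite -[RHS]E1; apply: eq_Ec => x; rewrite conjc1 mulr1.
  by rewrite /nrm2 sqmod_real Er_cst expr1n /=; ring.
move=> /(nrm2_eq0 bf1); apply: filterS => x /eqP; rewrite subr_eq0 => /eqP //.
Qed.

Variable u : X -> R[i].
Hypotheses (hu : multiplicative_fun u) (u0 : Ec mu u = 0).

Let u1 x : sqmod (u x) = 1. Proof. by case: hu. Qed.
Let bu : bounded_mc u. Proof. by case: hu. Qed.
Let un0 x : u x != 0. Proof. exact: sqmod_1_neq0. Qed.

Implicit Types (p q : {poly int}) (x : X).

(** [u] raised to the polynomial [p], where [X] acts as composition with [T].  The
    exponents are integers, and [u] does not vanish. *)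
Definition polypow (p : {poly int}) (x : X) : R[i] :=
  \prod_(j < size p) u (iter j T x) ^ p`_j.

Lemma polypow_wide n p x : (size p <= n)%N -> polypow p x = \prod_(j < n) u (iter j T x) ^ p`_j.
Proof.
move=> pn; rewrite /polypow (big_ord_widen n (fun j => u (iter j T x) ^ p`_j)) //.
rewrite big_mkcond /=; apply: eq_bigr => j _; case: ltnP => // pj.
by rewrite nth_default // expr0z.
Qed.

Lemma multf_polypow p : multiplicative_fun (polypow p).
Proof. by apply: multf_prod => j; apply: multfX; exact: multf_iter. Qed.

Lemma polypow_sqmod p x : sqmod (polypow p x) = 1.
Proof. by have [] := multf_polypow p. Qed.

Lemma polypow_neq0 p x : polypow p x != 0.
Proof. exact/sqmod_1_neq0/polypow_sqmod. Qed.

Lemma polypowD p q x : polypow (p + q) x = polypow p x * polypow q x.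
Proof.
set n := maxn (size p) (size q).
rewrite (@polypow_wide n (p + q)) ?size_polyD // (@polypow_wide n p) ?leq_maxl //.
rewrite (@polypow_wide n q) ?leq_maxr // -big_split; apply: eq_bigr => j _ /=.
by rewrite coefD expfzDr.
Qed.

Lemma polypow0 x : polypow 0 x = 1.
Proof. by rewrite /polypow size_poly0 big_ord0. Qed.

Lemma polypowN p x : polypow (- p) x = (polypow p x)^-1.
Proof.
apply: (mulfI (polypow_neq0 p x)); rewrite -polypowD subrr polypow0 mulfV //; exact: polypow_neq0.
Qed.

Lemma polypowC c p x : polypow (c%:P * p) x = polypow p x ^ c.
Proof.
rewrite (@polypow_wide (size p)); last by rewrite mul_polyC size_scale_leq.
rewrite /polypow; elim/big_rec2: _ => [|j y1 y2 _ ->]; first by rewrite exp1rz.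
by rewrite expfzMl coefCM [c * _]mulrC exprz_exp.
Qed.

Lemma polypowX p x : polypow ('X * p) x = polypow p (T x).
Proof.
rewrite (@polypow_wide (size p).+1); last first.
  by rewrite mulrC; have [->|p0] := eqVneq p 0; rewrite ?mul0r ?size_poly0 // size_mulX.
rewrite big_ord_recl coefXM eqxx expr0z mul1r; apply: eq_bigr => j _.
by rewrite coefXM /= -iterSr.
Qed.

Lemma polypowXn n p x : polypow ('X^n * p) x = polypow p (iter n T x).
Proof.
elim: n p x => [|n IH] p x; first by rewrite expr0 mul1r.
by rewrite exprS -mulrA polypowX IH -iterSr.
Qed.

Lemma polypow1 x : polypow 1 x = u x.
Proof. by rewrite /polypow size_poly1 big_ord1 coefC eqxx expr1z. Qed.

Definition annihilator (p : {poly int}) : Prop := {ae mu, forall x, polypow p x = 1}.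

Lemma annihilatorD p q : annihilator p -> annihilator q -> annihilator (p + q).
Proof. by apply: filterS2 => x px qx; rewrite polypowD px qx mulr1. Qed.

Lemma annihilatorM p q : annihilator p -> annihilator (q * p).
Proof.
move=> Ip; elim/poly_ind: q => [|q c IH].
  by rewrite mul0r; apply: aeW => x; rewrite polypow0.
rewrite mulrDl; apply: annihilatorD.
  rewrite -mulrA ['X * p]mulrC mulrA mulrC.
  by apply: filterS (ae_iter 1 IH) => x; rewrite polypowX.
by apply: filterS Ip => x; rewrite polypowC => ->; rewrite exp1rz.
Qed.

Lemma polypow_dichotomy p : Ec mu (polypow p) = 0 \/ Ec mu (polypow p) = 1 /\ annihilator p.
Proof. exact: multf_dichotomy (multf_polypow p). Qed.

Lemma annihilator1 : ~ annihilator 1.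
Proof.
move=> I1.
have : Ec mu u = 1.
  rewrite -[RHS](Ec_cst mu); apply: Ec_ae => //; first exact: bmc_cst.
  by apply: filterS I1 => x; rewrite polypow1.
by rewrite u0 => /eqP; rewrite eq_sym oner_eq0.
Qed.

Let bpolypow p : bounded_mc (polypow p). Proof. by have [] := multf_polypow p. Qed.

(** If [q] is not in the annihilator then [polypow q] and its translates have mean
    zero.  The hypothesis makes the sum [S] of the translates from [k] to [l - 1]
    invariant, so [S = 0] by ergodicity.  But the inner product of [S] with its
    first term is a sum of means of multiplicative functions, each of them [0]
    or [1], the first of them being [1]. *)
Lemma annihilator_saturated k l q : (k < l)%N ->
  annihilator (('X^l - 'X^k) * q) -> annihilator q.
Proof.
move=> kl Ikl.
have [E0|[_ //]] := polypow_dichotomy q.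
pose w j x := polypow ('X^j * q) x.
have w_lk : {ae mu, forall x, w l x = w k x}.
  apply: filterS Ikl => x; rewrite mulrDl mulNr polypowD polypowN -/(w l x) -/(w k x) => h.
  by rewrite -[LHS](divfK (polypow_neq0 ('X^k * q) x)) h mul1r.
have wT j x : w j (T x) = w j.+1 x by rewrite /w exprS -mulrA polypowX.
pose S x := \sum_(k <= j < l) w j x.
have bS : bounded_mc S by apply: bmc_sum => j; exact: bpolypow.
have ST : {ae mu, forall x, S (T x) = S x}.
  apply: filterS w_lk => x wx; rewrite /S.
  under eq_bigr do rewrite wT.
  case: l kl wx {Ikl bS S} => // l; rewrite ltnS => kl wx.
  by rewrite big_nat_recr //= [RHS]big_ltn // wx addrC big_add1.
have ES : Ec mu S = 0.
  rewrite /S Ec_sum; last by move=> j; exact: bpolypow.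
  apply: big1_seq => j _; rewrite -[RHS]E0 -[RHS](Ec_iter j (bpolypow q)).
  by apply: eq_Ec => x; rewrite /w polypowXn.
have S0 : {ae mu, forall x, S x = 0}.
  case: bS => rS jS; have [E1 E2] := Ec_eq0 ES.
  have h1 : {ae mu, forall x, Re (S x) = 0}.
    by apply: ergodic_mean0 => //; apply: filterS ST => x ->.
  have h2 : {ae mu, forall x, Im (S x) = 0}.
    by apply: ergodic_mean0 => //; apply: filterS ST => x ->.
  apply: filterS2 h1 h2 => x; by case: (S x) => a b /= -> ->.
have : Ec mu (fun x => S x * (w k x)^*%C) = 0.
  rewrite -[RHS](Ec_cst mu); apply: Ec_ae; [|exact: bmc_cst|].
    by apply: bmcM => //; apply: bmc_conj; exact: bpolypow.
  by apply: filterS S0 => x ->; rewrite mul0r.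
have -> : (fun x => S x * (w k x)^*%C) =
    (fun x => \sum_(k <= j < l) polypow (('X^j - 'X^k) * q) x).
  apply/funext => x; rewrite /S mulr_suml; apply: eq_bigr => j _.
  by rewrite mulrBl polypowD polypowN sqmod_1_inv ?polypow_sqmod.
rewrite Ec_sum; last by move=> j; exact: bpolypow.
rewrite big_ltn // subrr mul0r (_ : polypow 0 = (fun=> 1)); last exact/funext/polypow0.
rewrite Ec_cst => h; exfalso.
have : 0 <= \sum_(k.+1 <= j < l) Ec mu (polypow (('X^j - 'X^k) * q)).
  by apply: sumr_ge0 => j _; case: (polypow_dichotomy (('X^j - 'X^k) * q)) => [->|[-> _]].
rewrite -(lerD2l 1) h addr0 => /(lt_le_trans ltr01); by rewrite ltxx.
Qed.

Lemma Er_sum (I : Type) (r : seq I) (Q : pred I) (F : I -> X -> R) :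
  (forall i, bounded_mf (F i)) ->
  bounded_mf (fun x => \sum_(i <- r | Q i) F i x) /\
  Er mu (fun x => \sum_(i <- r | Q i) F i x) = \sum_(i <- r | Q i) Er mu (F i).
Proof.
move=> bF; elim: r => [|i r [b IH]].
  rewrite big_nil -[RHS](Er_cst mu).
  have -> : (fun x => \sum_(i <- [::] | Q i) F i x) = (fun=> 0).
    by apply/funext => x; rewrite big_nil.
  by split=> //; exact: bmf_cst.
have -> : (fun x => \sum_(j <- i :: r | Q j) F j x) =
  (fun x => (if Q i then F i x else 0) + \sum_(j <- r | Q j) F j x).
  by apply/funext => x; rewrite big_cons; case: (Q i); rewrite ?add0r.
rewrite big_cons; case: (Q i).
  by split; [exact: bmfD|rewrite ErD // IH].
have -> : (fun x => 0 + \sum_(j <- r | Q j) F j x) = (fun x => \sum_(j <- r | Q j) F j x).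
  by apply/funext => x; rewrite add0r.
by [].
Qed.

Lemma bmf_prod (I : Type) (r : seq I) (F : I -> X -> R) :
  (forall i, bounded_mf (F i)) -> bounded_mf (fun x => \prod_(i <- r) F i x).
Proof.
move=> bF; elim: r => [|i r IH].
  by (under eq_fun do rewrite big_nil); exact: bmf_cst.
by (under eq_fun do rewrite big_cons); exact: bmfM.
Qed.

(** * Riesz products and positive entropy *)
Section RieszProduct.
Variable k : nat.
Hypothesis free : forall p : {poly int}, p != 0 -> (forall i, `|p`_i| <= 1) ->
  ~ annihilator (p \Po 'X^k).

Let z (j : nat) (x : X) := u (iter (k * j) T x).

Let bz j : bounded_mc (z j).
Proof. by apply: (bmc_comp (mfun_iter _) bu). Qed.

Let z1 j x : sqmod (z j x) = 1.
Proof. exact: u1. Qed.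

Section Coefficients.
Variable m : nat.
Implicit Type f : {ffun 'I_m -> 'I_3}.

(** The letters [0, 1, 2] stand for the coefficients [-1, 0, 1]. *)
Definition sign_poly f : {poly int} :=
  \poly_(j < m) oapp (fun i : 'I_m => (f i)%:Z - 1) 0 (insub j).

Lemma coef_sign_poly f (i : 'I_m) : (sign_poly f)`_i = (f i)%:Z - 1.
Proof. by rewrite coef_poly ltn_ord valK. Qed.

Lemma sign_poly_flat f i : `|(sign_poly f)`_i| <= 1.
Proof.
rewrite coef_poly; case: ltnP => // im; rewrite insubT /=.
by have := ltn_ord (f (Ordinal im)); case: (f _ : nat) => [|[|[|]]].
Qed.

Lemma sign_poly_eq0 f : (sign_poly f == 0) = (f == [ffun=> inord 1]).
Proof.
apply/eqP/eqP => [f0|->].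
  apply/ffunP => i; rewrite ffunE; apply/val_inj; rewrite /= inordK //.
  have := coef_sign_poly f i; rewrite f0 coef0 => /eqP.
  by rewrite eq_sym subr_eq0 => /eqP [].
apply/polyP => i; rewrite coef_poly coef0; case: ltnP => // im.
by rewrite insubT /= ffunE inordK.
Qed.

Lemma polypow_sign_poly f x :
  polypow (sign_poly f \Po 'X^k) x = \prod_(j < m) z j x ^ ((f j)%:Z - 1).
Proof.
rewrite /sign_poly poly_def raddf_sum /=.
rewrite (_ : \sum_(j < m) _ = \sum_(j < m) ((f j)%:Z - 1)%:P * ('X^(k * j) * 1)); last first.
  apply: eq_bigr => j _; rewrite valK /= comp_polyZ rmorphXn /= comp_polyX -exprM.
  by rewrite mulr1 mul_polyC.
elim/big_rec2: _ => [|j y p _ ih]; first by rewrite polypow0.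
by rewrite polypowD polypowC polypowXn polypow1 ih.
Qed.

Lemma Ec_sign_poly f : Ec mu (polypow (sign_poly f \Po 'X^k)) = (f == [ffun=> inord 1])%:R.
Proof.
have [->|fn1] := eqVneq f [ffun=> inord 1].
  have /eqP -> : sign_poly [ffun=> inord 1] == 0 by rewrite sign_poly_eq0.
  rewrite comp_poly0 -[RHS](Ec_cst mu); apply: eq_Ec => x; exact: polypow0.
have [//|[_ A]] := polypow_dichotomy (sign_poly f \Po 'X^k).
by exfalso; apply: free A; [rewrite sign_poly_eq0|exact: sign_poly_flat].
Qed.

(** The coefficient of [w ^ (e - 1)] in [1 + Re (a / w)], for [|w| = 1]. *)
Definition riesz_coef (a : R[i]) (e : 'I_3) : R[i] :=
  match (e : nat) with 0%N => a / 2 | 1%N => 1 | _ => a^*%C / 2 end.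

Lemma riesz_factor (a w : R[i]) : sqmod w = 1 ->
  \sum_(e < 3) riesz_coef a e * w ^ (e%:Z - 1) = (1 + Re (a * w^*%C))%:C%C.
Proof.
move=> w1; rewrite !big_ord_recl big_ord0 /riesz_coef /= addr0.
rewrite (_ : w ^ (0%:Z - 1) = w^*%C); last by rewrite sub0r -sqmod_1_inv // exprN1.
rewrite (_ : _ ^ (_ - 1) = 1); last by rewrite expr0z.
rewrite (_ : w ^ (_ - 1) = w); last by rewrite expr1z.
rewrite rmorphD /= ReJ_add rmorphM /= conjcK; by field.
Qed.

(** Expanding the product gives a combination of the [u^p], for [p] flat in [X^k].
    By freeness only the term [p = 0] has a nonzero mean, and its coefficient is
    [1]. *)
Lemma Er_riesz x : Er mu (fun y => \prod_(j < m) (1 + Re (z j x * (z j y)^*%C))) = 1.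
Proof.
apply: complexI; rewrite -Ec_real.
transitivity (Ec mu (fun y => \sum_(f : {ffun 'I_m -> 'I_3})
   (\prod_(j < m) riesz_coef (z j x) (f j)) * polypow (sign_poly f \Po 'X^k) y)).
  apply: eq_Ec => y; rewrite rmorph_prod /=.
  under eq_bigr do rewrite -riesz_factor //.
  rewrite bigA_distr_bigA; apply: eq_bigr => f _.
  by rewrite polypow_sign_poly -big_split.
rewrite Ec_sum; last first.
  move=> f; apply: bmcM; first exact: bmc_cst.
  by case: (multf_polypow (sign_poly f \Po 'X^k)).
rewrite (bigD1 [ffun=> inord 1]) //= [X in _ + X]big1 ?addr0.
  rewrite EcZ; last by case: (multf_polypow (sign_poly [ffun=> inord 1] \Po 'X^k)).
  rewrite Ec_sign_poly eqxx mulr1 big1 // => j _.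
  by rewrite ffunE /riesz_coef inordK.
move=> f fn; rewrite EcZ; last by case: (multf_polypow (sign_poly f \Po 'X^k)).
by rewrite Ec_sign_poly (negPf fn) mulr0.
Qed.

End Coefficients.

Lemma sqmod_1_Re (w : R[i]) : sqmod w = 1 -> 0 <= 1 + Re w.
Proof.
case: w => a b; rewrite /sqmod /= => e.
have h2 : a ^+ 2 <= 1 by have := sqr_ge0 b; lra.
by rewrite leNgt; apply/negP => h3; nra.
Qed.

(** The signs of the coordinates and of the difference of their moduli cut the circle
    into arcs of an eighth of a turn. *)
Definition octant (w : R[i]) : bool * bool * bool :=
  (0 <= Re w, 0 <= Im w, `|Re w| <= `|Im w|).

(** The coordinate of larger modulus is the same for both points; it has the same sign
    in both and its square is at least [1/2]. *)
Lemma octant_close (w w' : R[i]) : sqmod w = 1 -> sqmod w' = 1 -> octant w = octant w' ->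
  1 / 2 <= Re (w * w'^*%C).
Proof.
have sqr_half (b b' : R) : 1 / 2 <= b ^+ 2 -> 1 / 2 <= b' ^+ 2 -> 0 <= b * b' -> 1 / 2 <= b * b'.
  move=> h h' p; rewrite -(@ler_pXn2r _ 2) // ?nnegrE //.
  by rewrite [leLHS]expr2 [leRHS]exprMn; apply: ler_pM.
have sg (b b' : R) : (0 <= b) = (0 <= b') -> 0 <= b * b'.
  case: (lerP 0 b) => hb /esym hb'; first exact: mulr_ge0.
  by rewrite nmulr_rge0 // ltW // real_ltNge ?num_real // hb'.
have half_le (a b : R) : a ^+ 2 + b ^+ 2 = 1 -> `|a| <= `|b| -> 1 / 2 <= b ^+ 2.
  move=> e h; have : a ^+ 2 <= b ^+ 2; last by lra.
  rewrite -[a ^+ 2]real_normK ?num_real // -[b ^+ 2]real_normK ?num_real //.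
  by rewrite ler_pXn2r ?nnegrE.
case: w w' => [a b] [a' b'].
rewrite /sqmod /octant /= mulrN opprK => e e' [s1 s2].
have p1 := sg _ _ s1; have p2 := sg _ _ s2.
case: (lerP `|a| `|b|) => h /esym h'.
  by have := sqr_half b b' (half_le _ _ e h) (half_le _ _ e' h') p2; lra.
have {}h' : `|b'| <= `|a'| by rewrite ltW // ltNge h'.
have {}e : b ^+ 2 + a ^+ 2 = 1 by rewrite addrC.
have {}e' : b' ^+ 2 + a' ^+ 2 = 1 by rewrite addrC.
by have := sqr_half a a' (half_le _ _ e (ltW h)) (half_le _ _ e' h') p1; lra.
Qed.

Local Notation nI := #|{: bool * bool * bool}|.

Definition label (x : X) : 'I_nI := enum_rank (octant (u x)).

Definition cell (i : 'I_nI) : set X := [set x | label x = i].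

Lemma cell_measurable i : measurable (cell i).
Proof.
have [[mr _] [mi _]] := bu.
have m1 (f g : X -> R) (b : bool) : measurable_fun setT f -> measurable_fun setT g ->
    measurable [set x | (f x <= g x) = b].
  move=> mf mg; have := measurable_fun_ler mf mg measurableT (Y := [set b]) I.
  by rewrite setTI.
have -> : cell i = [set x | (0 <= Re (u x)) = (enum_val i).1.1] `&`
    [set x | (0 <= Im (u x)) = (enum_val i).1.2] `&`
    [set x | (`|Re (u x)| <= `|Im (u x)|) = (enum_val i).2].
  apply/seteqP; split=> x /=.
    by rewrite /cell /label /= => <-; rewrite enum_rankK.
  move=> [[h1 h2] h3]; rewrite /cell /label /= /octant h1 h2 h3.
  by rewrite -[RHS]enum_valK; congr enum_rank; case: (enum_val i) => [[]].
apply: measurableI; first apply: measurableI.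
- by apply: m1 => //; exact: measurable_cst.
- by apply: m1 => //; exact: measurable_cst.
- by apply: m1; exact: measurableT_comp.
Qed.

Lemma cell_partition : measurable_partition cell.
Proof.
split; first exact: cell_measurable.
- apply/trivIsetP => i j _ _ ij; apply/seteqP; split=> // x [h1 h2].
  by move: ij; rewrite -(h1 : label x = i) -(h2 : label x = j) eqxx.
- by apply/seteqP; split=> // x _; exists (label x).
Qed.

Definition name n (x : X) : {ffun 'I_n -> 'I_nI} := [ffun j => label (iter (j : 'I_n) T x)].

Lemma joinE n (w : {ffun 'I_n -> 'I_nI}) :
  @iterated_join X T _ cell n w = [set x | name n x = w].
Proof.
apply/seteqP; split=> x /=.
  by move=> h; apply/ffunP => j; rewrite ffunE; exact: h.
by move=> <- j _ /=; rewrite /cell /= ffunE.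
Qed.

Lemma join_measurable n (w : {ffun 'I_n -> 'I_nI}) : measurable [set x | name n x = w].
Proof.
rewrite -joinE; apply: fin_bigcap_measurable => // j _.
by have := mfun_iter j measurableT (cell_measurable (w j)); rewrite setTI.
Qed.

Let word_mass n (w : {ffun 'I_n -> 'I_nI}) : R := fine (mu (@iterated_join X T _ cell n w)).

Let indic_name n (w : {ffun 'I_n -> 'I_nI}) :
  (fun x => (name n x == w)%:R) = \1_[set x | name n x = w] :> (X -> R).
Proof.
apply/funext => x; rewrite indicE; congr (_%:R); congr (nat_of_bool _).
by apply/eqP/idP; rewrite inE.
Qed.

Let bmf_name n (w : {ffun 'I_n -> 'I_nI}) : bounded_mf (fun x => (name n x == w)%:R : R).
Proof. by rewrite indic_name; apply: bmf_indic; exact: join_measurable. Qed.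

Let word_massE n (w : {ffun 'I_n -> 'I_nI}) : word_mass w = Er mu (fun x => (name n x == w)%:R).
Proof. by rewrite /word_mass joinE indic_name Er_indic //; exact: join_measurable. Qed.

(** Let [x] have the name [w].  The Riesz product centred at [x] is nonnegative and has
    mean [1].  A point with the same name over a time [n > k (m - 1)] is in the
    same octant as [x] at the times [0, k, ..., k (m - 1)], so that each of the
    [m] factors is at least [3/2] there. *)
Lemma cell_bound n m (w : {ffun 'I_n -> 'I_nI}) : (k * m.-1 < n)%N || (m == 0%N) ->
  word_mass w * (3 / 2) ^+ m <= 1.
Proof.
move=> mn.
have [[x xw]|none] := pselect (exists x, name n x = w); last first.
  rewrite /word_mass joinE (_ : [set x | _] = set0) ?measure0 ?mul0r //.
  by apply/seteqP; split=> // x xw; case: none; exists x.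
have bP j : bounded_mf (fun y => 1 + Re (z j x * (z j y)^*%C)).
  apply: bmfD; first exact: bmf_cst.
  have [] // : bounded_mc (fun y => z j x * (z j y)^*%C).
  by apply: bmcM; [exact: bmc_cst|exact: bmc_conj].
rewrite -[leRHS](Er_riesz m x) word_massE mulrC -ErZ //.
apply: le_Er.
- by apply: bmfM => //; exact: bmf_cst.
- by apply: bmf_prod => j; exact: bP.
move=> y; have [yw|] := eqVneq (name n y) w; last first.
  move=> _; rewrite mulr0; apply: prodr_ge0 => j _.
  by apply: sqmod_1_Re; rewrite sqmodM sqmod_conj !z1 mulr1.
rewrite mulr1 -[m in X in X <= _]card_ord -prodr_const; apply: ler_prod => j _.
apply/andP; split; first by rewrite divr_ge0.
have jn : (k * j < n)%N.
  move: mn; have jm := ltn_ord j; have -> /= : (m == 0%N) = false by case: m j jm => [[]|].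
  rewrite orbF; apply: leq_ltn_trans; rewrite leq_mul2l -ltnS prednK ?jm ?orbT //.
  by apply: leq_ltn_trans jm.
have := octant_close (z1 j x) (z1 j y); rewrite /z.
have /ffunP /(_ (Ordinal jn)) : name n x = name n y by rewrite xw yw.
rewrite !ffunE /= /label => /enum_rank_inj E /(_ E) h.
by rewrite (_ : 3 / 2 = 1 + 1 / 2) ?lerD2l //; field.
Qed.

Let H n : R := partition_entropy mu (@iterated_join X T _ cell n).

Let HE n : H n = - \sum_w @word_mass n w * ln (@word_mass n w). Proof. by []. Qed.

Lemma word_mass_ge0 n (w : {ffun 'I_n -> 'I_nI}) : 0 <= word_mass w.
Proof. by rewrite /word_mass fine_ge0. Qed.

Let sum_name (W : finType) (Q : pred W) (w : W) : \sum_(v | Q v) ((w == v)%:R : R) = (Q w)%:R.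
Proof.
have [Qw|nQw] := boolP (Q w); last first.
  by rewrite big1 // => v Qv; case: eqP => // wv; move: nQw; rewrite wv Qv.
rewrite (bigD1 w) //= eqxx big1 ?addr0 // => v /andP[_ vw].
by rewrite eq_sym (negPf vw).
Qed.

Lemma word_mass_sum n (Q : pred {ffun 'I_n -> 'I_nI}) :
  \sum_(w | Q w) word_mass w = Er mu (fun x => (Q (name n x))%:R).
Proof.
under eq_bigr do rewrite word_massE.
have [_ <-] := Er_sum (index_enum _) Q (fun w => @bmf_name n w).
by apply: eq_Er => x; exact: sum_name.
Qed.

Lemma word_mass_sum1 n : \sum_w @word_mass n w = 1.
Proof. by rewrite (word_mass_sum predT) Er_cst. Qed.

Let head_word m n (w : {ffun 'I_(m + n) -> 'I_nI}) : {ffun 'I_m -> 'I_nI} :=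
  [ffun i => w (lshift n i)].
Let tail_word m n (w : {ffun 'I_(m + n) -> 'I_nI}) : {ffun 'I_n -> 'I_nI} :=
  [ffun j => w (rshift m j)].

Lemma entropy_join_subadditive m n : H (m + n)%N <= H m + H n.
Proof.
rewrite !HE; apply: (@entropy_subadditive _ _ _ _ (@head_word m n) (@tail_word m n)).
- move=> w w' /ffunP h /ffunP t; apply/ffunP => i.
  have := splitK i; case: (fintype.split i) => j /= <-.
    by have := h j; rewrite !ffunE.
  by have := t j; rewrite !ffunE.
- by move=> w; exact: word_mass_ge0.
- exact: word_mass_sum1.
- move=> v; rewrite word_mass_sum word_massE; apply: eq_Er => x.
  congr (_%:R); congr (nat_of_bool (_ == _)).
  by apply/ffunP => j; rewrite !ffunE.
- move=> v; rewrite word_mass_sum word_massE.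
  transitivity (Er mu (fun x => (name n (iter m T x) == v)%:R)).
    apply/esym; apply: (@Er_comp _ _ _ _ _ mu mu (iter m T) (fun x => (name n x == v)%:R)).
    - exact: mfun_iter.
    - by move=> A mA; exact: mu_iter.
    - exact: bmf_name.
  apply: eq_Er => x; congr (_%:R); congr (nat_of_bool (_ == _)).
  by apply/ffunP => j; rewrite !ffunE /= addnC iterD.
Qed.

Lemma entropy_join_ge n m : (k * m.-1 < n)%N || (m == 0%N) -> m%:R * ln (3 / 2) <= H n.
Proof.
move=> mn; rewrite HE -sumrN -[leLHS]mul1r.
rewrite [X in X * (_ * _)](esym (word_mass_sum1 n)) mulr_suml.
apply: ler_sum => w _.
have [->|p0] := eqVneq (word_mass w) 0; first by rewrite !mul0r oppr0.
have ppos : 0 < word_mass w by rewrite lt_def p0 word_mass_ge0.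
rewrite -mulrN ler_wpM2l ?word_mass_ge0 // -subr_le0 opprK addrC.
have q0 : 0 < (3 / 2 : R) by rewrite divr_gt0.
rewrite mulr_natl -lnXn // -lnM ?posrE ?exprn_gt0 // ln_le0 //.
exact: cell_bound.
Qed.

(** The entropy of the join of length [n] is at least [m ln (3/2)] for [m = n %/ k],
    and [n <= 2 k m] as soon as [n >= k].  Subadditivity makes the entropy rate an
    actual limit, so that it inherits the bound. *)
Lemma free_entropy_gt0 : (0 < k)%N -> (0 < ks_entropy mu T)%E.
Proof.
move=> k0.
have l0 : 0 < ln (3 / 2) :> R by rewrite ln_gt0 // ltr_pdivlMr // mul1r ltr_nat.
have H0 n : 0 <= H n.
  by apply: le_trans (@entropy_join_ge n 0 _); rewrite ?mul0r ?eqxx ?orbT.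
have [L HL] := fekete H0 entropy_join_subadditive.
pose c : R := ln (3 / 2) / (2 * k%:R).
have kR : 0 < k%:R :> R by rewrite ltr0n.
have c0 : 0 < c by rewrite /c divr_gt0 // mulr_gt0.
have cL : c <= L.
  rewrite -(cvg_lim _ HL) //; apply: limr_ge; first by apply/cvg_ex; exists L.
  exists k => // n /= kn.
  have n0 : (0 < n)%N by apply: leq_trans kn.
  have nR : 0 < n%:R :> R by rewrite ltr0n.
  set m := (n %/ k)%N.
  have m0 : (0 < m)%N by rewrite divn_gt0.
  have nE := divn_eq n k.
  have nk := ltn_pmod n k0.
  rewrite -/m in nE.
  have mn : (k * m.-1 < n)%N.
    apply: leq_trans (leq_trunc_div n k); rewrite -/m [(m * k)%N]mulnC ltn_mul2l k0 /=.
    by rewrite prednK.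
  have n2 : (n <= 2 * k * m)%N.
    rewrite nE; apply: (@leq_trans (m * k + k)%N); first by rewrite leq_add2l ltnW.
    rewrite -mulnA mul2n -addnn mulnC leq_add2l; exact: leq_pmulr.
  rewrite ler_pdivlMr //; apply: le_trans (@entropy_join_ge n m _); last by rewrite mn.
  rewrite /c [m%:R * _]mulrC -mulrA ler_wpM2l ?(ltW l0) // mulrC ler_pdivrMr ?mulr_gt0 //.
  by rewrite -(natrM _ 2 k) -natrM ler_nat mulnC.
apply: (@lt_le_trans _ _ L%:E); first by rewrite lte_fin (lt_le_trans c0).
apply: ereal_sup_ubound; exists nI, cell; split; first exact: cell_partition.
rewrite /partition_entropy_rate; apply/esym/cvg_lim => //.
by apply: cvg_EFin; [near=> n|exact: HL].
Unshelve. all: by end_near.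
Qed.

End RieszProduct.

End Dynamics.

Theorem proposition4p7 (R : realType) (d : measure_display)
    (X : measurableType d) (mu : probability X R) (T : X -> X)
    (hsys : dynamical_system mu T)
    (herg : ergodic mu T)
    (lambda : probability (X * X * X)%type R)
    (hjoin : self_joining3 mu T lambda)
    (hindep : pairwise_independent_marginals mu lambda)
    (G : topologicalZmodType)
    (hcompact : compact [set: G])
    (hmetr : metrizable R G)
    (xi : X -> G)
    (hxi : borel_measurable xi)
    (hnonconst : ~ exists c : G, {ae mu, forall x, xi x = c})
    (hsum : {ae lambda, forall p : X * X * X,
               xi p.2 = xi p.1.1 + xi p.1.2}) :
  (0 < ks_entropy mu T)%E.
Proof.
have [_ [S _ [mT _ pT]]] := hsys.
have [u [bu u1 u0 um]] :=
  exists_multiplicative hindep hjoin.2 hcompact hmetr hxi hnonconst hsum.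
have hu : multiplicative_fun lambda u by split.
apply: contrapT => ent0.
apply: (annihilator1 hu u0).
apply: saturated_ideal_full => [p q|p q|k l q|k k0].
- exact: (annihilatorD hu).
- exact: (annihilatorM mT pT hu).
- exact: (annihilator_saturated mT pT herg hjoin hindep hu).
- apply: contrapT => free; apply: ent0.
  apply: (free_entropy_gt0 mT pT hjoin hindep hu _ k0) => p p0 pc Ip.
  by apply: free; exists p.
Qed.
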